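(* Fix an integer $d\ge 1$, a real $0<\tau<1$, and a real $C>1/(1-\tau)$. For each $n$ let $V=(v_1,\ldots,v_n)$ be a labelled configuration of distinct points in $\mathbb{R}^d$ such that every subcollection of more than $\tau n$ of the points affinely spans $\mathbb{R}^d$. If each pair $\{i,j\}\in\binom{[n]}{2}$ has its distance $\mathrm{dist}(v_i,v_j)$ revealed independently with probability $p=C\ln n/n$, then w.h.p. the revealed distances determine $V$ up to Euclidean isometry. For $d=1$, the conclusion holds for every $C>1$ and every labelled configuration $V$ of distinct points in $\mathbb{R}$.
   Context: $[n]=\{1,\dots,n\}$ and $\mathrm{dist}$ is the Euclidean distance. The configuration $V$ (which may depend on $n$) is fixed before the randomness is revealed. A labelled configuration is an ordered tuple of distinct points. ''The revealed distances determine $V$ up to Euclidean isometry'' means: for every labelled configuration $U=(u_1,\ldots,u_n)$ of distinct points in $\mathbb{R}^d$ with $\mathrm{dist}(u_i,u_j)=\mathrm{dist}(v_i,v_j)$ for every revealed pair $\{i,j\}$, there is a Euclidean isometry $T$ of $\mathbb{R}^d$ with $Tu_i=v_i$ for all $i\in[n]$. ''W.h.p.'' means with probability tending to $1$ as $n\to\infty$; $p$ is considered for $n$ large enough that $p\le1$. *)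

(* Defs.v *)
From mathcomp Require Import all_boot all_order all_algebra.
From mathcomp Require Import all_classical all_reals all_analysis.
Import Order.TTheory GRing.Theory Num.Theory numFieldNormedType.Exports.

Set Implicit Arguments.
Unset Strict Implicit.
Unset Printing Implicit Defensive.

Local Open Scope ring_scope.

(* The library's norm on ['rV[R]_d] is the sup norm, hence this definition. *)
Definition edist (R : realType) (d : nat) (x y : 'rV[R]_d) : R :=
  Num.sqrt (\sum_(k < d) (x 0 k - y 0 k) ^+ 2).

Definition euclidean_isometry (R : realType) (d : nat)
    (T : 'rV[R]_d -> 'rV[R]_d) : Prop :=
  bijective T /\ forall x y, edist (T x) (T y) = edist x y.

Definition affinely_spans (R : realType) (d n : nat)
    (v : 'I_n -> 'rV[R]_d) (S : {set 'I_n}) : Prop :=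
  forall x : 'rV[R]_d, exists c : 'I_n -> R,
    \sum_(i in S) c i = 1 /\ \sum_(i in S) c i *: v i = x.

Definition large_subsets_span (R : realType) (d n : nat) (tau : R)
    (v : 'I_n -> 'rV[R]_d) : Prop :=
  forall S : {set 'I_n}, tau * n%:R < #|S|%:R -> affinely_spans v S.

Definition pair_of (n : nat) := {e : {set 'I_n} | #|e| == 2%N}.

Definition same_revealed_dist (R : realType) (d n : nat)
    (G : {set pair_of n}) (u v : 'I_n -> 'rV[R]_d) : Prop :=
  forall (e : pair_of n) (i j : 'I_n), e \in G -> val e = [set i; j] ->
    edist (u i) (u j) = edist (v i) (v j).

Definition determines (R : realType) (d n : nat)
    (v : 'I_n -> 'rV[R]_d) (G : {set pair_of n}) : Prop :=
  forall u : 'I_n -> 'rV[R]_d, injective u -> same_revealed_dist G u v ->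
    exists2 T : 'rV[R]_d -> 'rV[R]_d,
      euclidean_isometry T & forall i, T (u i) = v i.

(* The law of the set of revealed pairs: the product of Bernoulli(p) laws
   over all pairs, a probability distribution as soon as 0 <= p <= 1. *)
Definition reveal_weight (R : realType) (n : nat) (p : R)
    (G : {set pair_of n}) : R :=
  \prod_(e : pair_of n) (if e \in G then p else 1 - p).

Definition reveal_prob (R : realType) (n : nat) (p : R)
    (E : {set pair_of n} -> Prop) : R :=
  \sum_(G : {set pair_of n} | `[< E G >]) reveal_weight p G.

Lemma reveal_weight_ge0 (R : realType) (n : nat) (p : R)
    (G : {set pair_of n}) : 0 <= p -> p <= 1 -> 0 <= reveal_weight p G.
Proof.
by move=> p0 p1; apply: prodr_ge0 => e _; case: ifP => _ //; rewrite subr_ge0.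
Qed.

Lemma reveal_prob_independent (R : realType) (n : nat) (p : R)
    (F : {set pair_of n}) :
  reveal_prob p (fun G => F \subset G) = p ^+ #|F|.
Proof.
have := @bigA_distr R 0 1 *%R +%R (pair_of n)
  (fun=> p) (fun e => if e \in F then 0 else 1 - p).
rewrite (bigID (mem F)) /= (eq_bigr (fun=> p)); last first.
  by move=> e ->; rewrite addr0.
rewrite prodr_const [X in _ * X]big1 ?mulr1; last first.
  by move=> e /negbTE ->; rewrite addrC subrK.
move=> ->; rewrite /reveal_prob big_mkcond /=; apply: eq_bigr => G _.
rewrite asboolb; case: ifPn => [/fintype.subsetP FG|/fintype.subsetPn[e eF eG]].
  apply: eq_bigr => e _; case: ifPn => // eG.
  by rewrite ifN //; apply: contra eG => /FG.
by rewrite (bigD1 e) //= (negbTE eG) eF mul0r.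
Qed.

Lemma reveal_prob_total (R : realType) (n : nat) (p : R) :
  reveal_prob p (fun _ : {set pair_of n} => True) = 1.
Proof.
rewrite -[1](expr0 p) -[in RHS](cards0 (pair_of n)) -reveal_prob_independent.
by apply: eq_bigl => G; rewrite finset.sub0set !asboolT.
Qed.

(* Main.v *)
Require Import Defs.
From mathcomp Require Import all_boot all_order all_algebra.
From mathcomp Require Import all_classical all_reals all_analysis.
From mathcomp Require Import ring lra.
Import Order.TTheory GRing.Theory Num.Theory numFieldNormedType.Exports.

(** Write L = ln n, so that the average degree of the graph of revealed pairs
    is about C L, and for a configuration u let the mismatch of u be the set
    of pairs {i, j} with dist (u_i, u_j) different from dist (v_i, v_j). A
    configuration is compatible with the revealed set G when its mismatch
    does not meet G. There are infinitely many configurations, so no direct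
    union bound applies; the proof has two steps.

    Every compatible u has a small mismatch. The mismatches form a range
    space of low complexity: each condition on a pair is the vanishing of a
    quadratic polynomial in the n d coordinates of u, and a
    linear-independence argument (Ronyai, Babai, Ganapathy) bounds the number
    of traces of mismatches on m pairs by 'C(2 m + n d, n d)
    ([card_patterns]). The double sampling argument of Vapnik and Chervonenkis
    ([prob_net]) only needs to count traces on a sparse set, namely on the
    union of two independent samples. That set has m = O(n L) pairs, the
    number of traces on it is at most exp (c n L + O(n)) with c as small as
    desired, and one trace of a mismatch with delta n^2 pairs is avoided with
    probability exp (- Omega(delta n L)). Hence with high probability every
    compatible u has fewer than delta n^2 mismatched pairs
    ([prob_many_mismatches]).

    A small mismatch leaves only few stray points. The matrix of differences
    of squared distances has rank at most 2 d + 2, so if it has few nonzero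
    entries then it vanishes on a large principal block
    ([low_rank_zero_block]): u and v are congruent on a set T of at least
    (1 - eta) n indices. Since v spans the space on T, the congruence extends
    to an isometry Phi ([isometry_extension]). Let W be the set of the at most
    eta n indices w with Phi u_w different from v_w. For w in W, all revealed
    neighbours of w outside W lie in the hyperplane bisecting Phi u_w and v_w,
    and a hyperplane contains at most tau n points of v. All these
    neighbours lie in the flat spanned by at most d of them, which is contained
    in that hyperplane ([hyperplane_basis]); choosing them costs a factor
    (C L)^d only, up to a constant, because these pairs have to be revealed.
    So a given w is stray with probability at most
    (d + 1) (C L)^d n^(- C (1 - tau - eta)), the bounds for the points of W
    multiply, and C (1 - tau - eta) > 1 once eta is small: summing over W,
    with high probability W is empty ([prob_some_stray]).

    For d = 1 two distinct points span the line, so every tau > 0 satisfies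
    the hypothesis on V as soon as tau n is at least 1. *)

Set Implicit Arguments.
Unset Strict Implicit.
Unset Printing Implicit Defensive.

Local Open Scope ring_scope.

(** * Random subsets of a finite set *)

Section RandomSubset.
Variables (R : realType) (E : finType) (p : R).
Hypotheses (p_ge0 : 0 <= p) (p_le1 : p <= 1).
Implicit Types (G T S X : {set E}) (A B : {set E} -> Prop).

Definition weight G : R := \prod_(e : E) (if e \in G then p else 1 - p).

Definition prob A : R := \sum_(G : {set E} | `[< A G >]) weight G.

Lemma weight_ge0 G : 0 <= weight G.
Proof. by apply: prodr_ge0 => e _; case: ifP => _ //; rewrite subr_ge0. Qed.

(** The elements are independent, so the expectation of a product over all of
    them factors; every explicit expectation below is an instance. *)
Lemma sum_weight_prod (f g : E -> R) :
  \sum_(G : {set E}) weight G * \prod_(e : E) (if e \in G then f e else g e) =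
  \prod_(e : E) (p * f e + (1 - p) * g e).
Proof.
rewrite bigA_distr /=; apply: eq_bigr => G _.
by rewrite -big_split /=; apply: eq_bigr => e _; case: ifP.
Qed.

Lemma sum_weight : \sum_(G : {set E}) weight G = 1.
Proof.
have := sum_weight_prod (fun=> 1) (fun=> 1).
rewrite [RHS]big1 => [<-|e _]; last by rewrite !mulr1 addrC subrK.
apply: eq_bigr => G _; rewrite [X in _ * X]big1 ?mulr1 // => e _.
by case: ifP.
Qed.

Lemma probE A : prob A = \sum_(G : {set E}) weight G * `[< A G >]%:R.
Proof.
rewrite /prob big_mkcond /=; apply: eq_bigr => G _.
by case: ifP => _; rewrite ?mulr1 ?mulr0.
Qed.

Lemma prob_le_expect A (f : {set E} -> R) :
  (forall G, 0 <= f G) -> (forall G, A G -> 1 <= f G) ->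
  prob A <= \sum_(G : {set E}) weight G * f G.
Proof.
move=> f_ge0 f_ge1; rewrite probE; apply: ler_sum => G _.
apply: ler_wpM2l; first exact: weight_ge0.
by case: asboolP => [/f_ge1|].
Qed.

Lemma prob_le A B : (forall G, A G -> B G) -> prob A <= prob B.
Proof.
move=> AB; rewrite !probE; apply: ler_sum => G _.
apply: ler_wpM2l; first exact: weight_ge0.
by rewrite ler_nat; case: asboolP => // /AB BG; rewrite asboolT.
Qed.

Lemma prob_le1 A : prob A <= 1.
Proof.
rewrite -sum_weight probE; apply: ler_sum => G _.
by rewrite ler_piMr ?weight_ge0 //; case: asboolP.
Qed.

Lemma probU A B : prob (fun G => A G \/ B G) <= prob A + prob B.
Proof.
rewrite !probE -big_split /=; apply: ler_sum => G _.
rewrite -mulrDr; apply: ler_wpM2l; first exact: weight_ge0.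
rewrite -natrD ler_nat; case: asboolP => // [[AG|BG]].
  by rewrite (asboolT AG).
by rewrite (asboolT BG) addnC.
Qed.

Lemma probC A : prob (fun G => ~ A G) = 1 - prob A.
Proof.
rewrite -sum_weight !probE -sumrB; apply: eq_bigr => G _.
by rewrite asbool_neg; case: asboolP => _ /=; rewrite ?mulr1 ?mulr0; ring.
Qed.

Lemma prob_exists (I : finType) (P : pred I) (A : I -> {set E} -> Prop) :
  prob (fun G => exists2 i, P i & A i G) <= \sum_(i | P i) prob (A i).
Proof.
under eq_bigr do rewrite probE.
rewrite exchange_big /= probE; apply: ler_sum => G _.
rewrite -mulr_sumr; apply: ler_wpM2l; first exact: weight_ge0.
case: asboolP => [[i Pi AiG]|_]; last by apply: sumr_ge0 => i _.
rewrite (bigD1 i Pi) /= (asboolT AiG) lerDl.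
by apply: sumr_ge0.
Qed.

Lemma prob_cylinder S X : [disjoint S & X] ->
  prob (fun G => S \subset G /\ [disjoint X & G]) =
  p ^+ #|S| * (1 - p) ^+ #|X|.
Proof.
move=> SX.
have := sum_weight_prod (fun e => (e \notin X)%:R) (fun e => (e \notin S)%:R).
have -> : \prod_(e : E) (p * (e \notin X)%:R + (1 - p) * (e \notin S)%:R) =
    p ^+ #|S| * (1 - p) ^+ #|X| :> R.
  rewrite -!prodr_const (big_mkcond (mem S)) (big_mkcond (mem X)) -big_split.
  apply: eq_bigr => e _ /=; case: ifPn => eS.
    by rewrite (disjointFr SX eS) /=; ring.
  by case: ifPn => _ /=; ring.
move=> <-; rewrite probE; apply: eq_bigr => G _; congr (_ * _).
case: asboolP => [[/fintype.subsetP SG XG]|nSX].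
  rewrite big1 // => e _; case: ifPn => [eG|eG].
    by rewrite (disjointFl XG eG).
  by rewrite (contra _ eG) // => /SG.
case: (boolP (S \subset G)) => [SG|/fintype.subsetPn[e eS eG]]; last first.
  by rewrite (bigD1 e) //= (negbTE eG) eS mul0r.
case: (boolP [disjoint X & G]) => [XG|]; first by case: nSX.
rewrite -setI_eq0 => /set0Pn[e]; rewrite inE => /andP[eX eG].
by rewrite (bigD1 e) //= eG eX mul0r.
Qed.

(** Markov inequality for the expectation of [2 ^ #|G|]. *)
Lemma prob_card_gt m :
  prob (fun G => (m < #|G|)%N) <= (1 + p) ^+ #|E| / 2 ^+ m.
Proof.
apply: (@le_trans _ _ (\sum_(G : {set E}) weight G *
    ((\prod_(e : E) if e \in G then 2 else 1) / 2 ^+ m))).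
  have e2 G : \prod_(e : E) (if e \in G then 2 else 1) = 2 ^+ #|G| :> R.
    by rewrite -prodr_const [RHS]big_mkcond.
  apply: prob_le_expect => G; rewrite e2.
    by rewrite divr_ge0 ?exprn_ge0.
  move=> mG; rewrite ler_pdivlMr ?exprn_gt0 // mul1r.
  by rewrite ler_eXn2l ?ltr1n // ltnW.
under eq_bigr do rewrite mulrA.
rewrite -mulr_suml (sum_weight_prod (fun=> 2) (fun=> 1)).
rewrite prodr_const le_eqVlt; apply/orP; left; apply/eqP.
by congr (_ ^+ _ / _); ring.
Qed.

(** Markov inequality for the expectation of [2 ^ - #|S :&: G|]. *)
Lemma prob_cardI_lt S k :
  prob (fun G => (#|S :&: G| < k)%N) <= 2 ^+ k * (1 - p / 2) ^+ #|S|.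
Proof.
pose f e : R := if e \in S then 2^-1 else 1.
apply: (@le_trans _ _ (\sum_(G : {set E}) weight G *
    (2 ^+ k * (\prod_(e : E) if e \in G then f e else 1)))).
  have e2 G : \prod_(e : E) (if e \in G then f e else 1) =
      2^-1 ^+ #|S :&: G| :> R.
    rewrite -prodr_const [RHS]big_mkcond; apply: eq_bigr => e _.
    by rewrite /f inE andbC; case: ifP.
  apply: prob_le_expect => G; rewrite e2.
    by rewrite mulr_ge0 ?exprn_ge0 ?invr_ge0.
  move=> Gk; rewrite exprVn ler_pdivlMr ?exprn_gt0 // mul1r.
  by rewrite ler_eXn2l ?ltr1n // ltnW.
under eq_bigr do rewrite mulrCA.
rewrite -mulr_sumr (sum_weight_prod f (fun=> 1)).
rewrite -prodr_const [X in _ <= _ * X]big_mkcond /=.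
rewrite le_eqVlt; apply/orP; left; apply/eqP; congr (_ * _).
by apply: eq_bigr => e _; rewrite /f; case: ifP => _; field.
Qed.

End RandomSubset.

(** * Double sampling *)

Section Swap.
Variables (E : finType).
Implicit Types (G T S : {set E}).

(** Exchanging two independent samples on [S] gives two independent samples
    again; averaging over [S] turns the question which of the two samples an
    element came from into a fair coin toss. *)
Definition swap S G T : {set E} := (G :\: S) :|: (T :&: S).

Lemma swapK S G T : swap S (swap S G T) (swap S T G) = G.
Proof.
by apply/setP => e; rewrite !inE; case: (e \in S); case: (e \in G);
  case: (e \in T).
Qed.

Lemma swapU S G T : swap S G T :|: swap S T G = G :|: T.
Proof.
by apply/setP => e; rewrite !inE; case: (e \in S); case: (e \in G);
  case: (e \in T).
Qed.

Lemma weight_swap (R : realType) (p : R) S G T :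
  weight p (swap S G T) * weight p (swap S T G) = weight p G * weight p T.
Proof.
rewrite /weight -!big_split /=; apply: eq_bigr => e _; rewrite !inE.
by case: (e \in S); case: (e \in G); case: (e \in T) => //=; rewrite mulrC.
Qed.

Lemma sum_weight_swap (R : realType) (p : R) (f : {set E} -> {set E} -> R) S :
  \sum_(G : {set E}) \sum_(T : {set E})
     weight p G * weight p T * f (swap S G T) (swap S T G) =
  \sum_(G : {set E}) \sum_(T : {set E}) weight p G * weight p T * f G T.
Proof.
rewrite !pair_big /=.
rewrite [RHS](reindex_inj (h := fun x => (swap S x.1 x.2, swap S x.2 x.1))) /=.
  by apply: eq_bigr => -[G T] _ /=; rewrite weight_swap.
apply: (can_inj (g := fun x => (swap S x.1 x.2, swap S x.2 x.1))).
by move=> [G T] /=; rewrite !swapK.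
Qed.

(** Prescribing the intersection with [S] divides the number of sets by
    [2 ^ #|S|]. *)
Lemma card_setI_eq S T : T \subset S ->
  (#|[set X : {set E} | X :&: S == T]| * 2 ^ #|S| <= 2 ^ #|E|)%N.
Proof.
move=> TS.
have -> : (2 ^ #|E| = 2 ^ #|~: S| * 2 ^ #|S|)%N.
  by rewrite -expnD addnC cardsC.
rewrite leq_mul2r; apply/orP; right; rewrite -card_powerset.
rewrite -(card_in_imset (f := fun X => X :\: S)).
  apply: subset_leq_card; apply/fintype.subsetP => Y /imsetP[X _ ->].
  by rewrite inE; apply/fintype.subsetP => e; rewrite !inE => /andP[].
move=> X Y; rewrite !inE => /eqP XT /eqP YT XY.
by rewrite -(finset.setID X S) -(finset.setID Y S) XY XT YT.
Qed.

Lemma card_set_type : #|{set E}| = (2 ^ #|E|)%N.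
Proof. by rewrite -(cardsT E) -card_powerset finset.powersetT cardsT. Qed.

End Swap.

Section NetLemma.
Variables (R : realType) (E : finType) (p : R).
Hypotheses (p_ge0 : 0 <= p) (p_le1 : p <= 1).
Variables (family : {set E} -> Prop) (m k Phi : nat).
Implicit Types (G T S X Y : {set E}).

Definition traces X : {set {set E}} :=
  [set Y | `[< exists2 S, family S & Y = S :&: X >]].

Hypothesis card_traces : forall X, (#|X| <= m.*2)%N -> (#|traces X| <= Phi)%N.
Hypothesis heavy : forall S, family S ->
  prob p (fun T => (#|S :&: T| < k)%N) <= 2^-1.

Let missed G T := exists2 S, family S &
  S :&: G = finset.set0 /\ (k <= #|S :&: T|)%N.

(* A swap set compatible with the trace [Y] is determined on [Y]: it must move
   to the second sample precisely the elements of [Y] that are not in [T]. *)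
Let card_swap_missed G T : (#|G :|: T| <= m.*2)%N ->
  (#|[set S : {set E} | `[< missed (swap S G T) (swap S T G) >]]| * 2 ^ k
     <= Phi * 2 ^ #|E|)%N.
Proof.
move=> GTm; set tr := [set Y in traces (G :|: T) | (k <= #|Y|)%N].
have sub : [set S | `[< missed (swap S G T) (swap S T G) >]] \subset
    \bigcup_(Y in tr) [set X : {set E} | X :&: Y == Y :\: T].
  apply/fintype.subsetP => S; rewrite inE => /asboolP[Y famY [YG kY]].
  apply/bigcupP; exists (Y :&: (G :|: T)).
    rewrite !inE; apply/andP; split; first by apply/asboolP; exists Y.
    apply: leq_trans kY (subset_leq_card _); apply: finset.setIS.
    by rewrite -(swapU S) finset.subsetUr.
  rewrite inE; apply/eqP/setP => e; move/setP: YG => /(_ e).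
  rewrite !inE; case: (e \in S); case: (e \in Y); case: (e \in G);
    by case: (e \in T).
apply: (@leq_trans (\sum_(Y in tr) 2 ^ #|E|)%N); last first.
  rewrite sum_nat_const leq_mul2r; apply/orP; right.
  apply: leq_trans (card_traces GTm); apply: subset_leq_card.
  by apply/fintype.subsetP => Y; rewrite inE => /andP[].
apply: (@leq_trans ((\sum_(Y in tr)
    #|[set X : {set E} | X :&: Y == Y :\: T]|) * 2 ^ k)%N).
  rewrite leq_mul2r; apply/orP; right.
  apply: leq_trans (subset_leq_card sub) _.
  elim/big_rec2: _ => [|Y a b _ le_ba]; first by rewrite cards0.
  by apply: leq_trans (leq_card_setU _ _) _; rewrite leq_add2l.
rewrite big_distrl /=; apply: leq_sum => Y; rewrite inE => /andP[_ kY].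
apply: leq_trans (card_setI_eq (subsetDl Y T)).
by rewrite leq_mul2l leq_exp2l // kY orbT.
Qed.

Let prob_missed : \sum_(G : {set E}) \sum_(T : {set E})
   weight p G * weight p T * `[< missed G T >]%:R <=
   2 * prob p (fun G => (m < #|G|)%N) + Phi%:R / 2 ^+ k.
Proof.
set L := leLHS.
have -> : L = (2 ^+ #|E|)^-1 * \sum_(G : {set E}) \sum_(T : {set E})
    weight p G * weight p T *
    #|[set S : {set E} | `[< missed (swap S G T) (swap S T G) >]]|%:R.
  have -> : 2 ^+ #|E| = #|{set E}|%:R :> R by rewrite card_set_type natrX.
  apply: (canRL (mulKf _)); first by rewrite card_set_type natrX expf_neq0.
  rewrite mulr_natl -sumr_const.
  rewrite (eq_bigr (fun S => \sum_(G : {set E}) \sum_(T : {set E})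
      weight p G * weight p T *
      `[< missed (swap S G T) (swap S T G) >]%:R)); last first.
    move=> S _.
    by rewrite (sum_weight_swap p (fun G T => `[< missed G T >]%:R) S).
  rewrite exchange_big; apply: eq_bigr => G _.
  rewrite exchange_big; apply: eq_bigr => T _.
  rewrite -mulr_sumr -natr_sum; congr (_ * _%:R).
  rewrite -sum1_card [RHS]big_mkcond /=; apply: eq_bigr => S _.
  by rewrite inE; case: asboolP.
have bound G T :
    (2 ^+ #|E|)^-1 * #|[set S | `[< missed (swap S G T) (swap S T G) >]]|%:R
    <= (m < #|G|)%N%:R + (m < #|T|)%N%:R + Phi%:R / 2 ^+ k :> R.
  have [/orP mGT|] := boolP ((m < #|G|)%N || (m < #|T|)%N).
    apply: (@le_trans _ _ 1).
      rewrite ler_pdivrMl ?exprn_gt0 // mulr1 -natrX ler_nat -card_set_type.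
      exact: max_card.
    rewrite -natrD -[X in X <= _]addr0 lerD ?divr_ge0 ?exprn_ge0 //.
    by rewrite ler1n; case: mGT => ->; rewrite ?addn1.
  rewrite negb_or -!leqNgt => /andP[Gm Tm].
  rewrite (leq_gtF Gm) (leq_gtF Tm) !add0r.
  rewrite ler_pdivrMl ?exprn_gt0 // mulrA ler_pdivlMr ?exprn_gt0 //.
  rewrite -!natrX -!natrM ler_nat mulnC [leqRHS]mulnC.
  rewrite mulnC card_swap_missed // -addnn.
  by apply: leq_trans (leq_card_setU _ _) (leq_add Gm Tm).
apply: (@le_trans _ _ (\sum_(G : {set E}) \sum_(T : {set E})
    weight p G * weight p T *
    ((m < #|G|)%N%:R + (m < #|T|)%N%:R + Phi%:R / 2 ^+ k))).
  rewrite mulr_sumr; apply: ler_sum => G _.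
  rewrite mulr_sumr; apply: ler_sum => T _.
  by rewrite mulrCA ler_wpM2l ?mulr_ge0 ?weight_ge0.
have sw := sum_weight E p.
under eq_bigr => G _.
  under eq_bigr do rewrite !mulrDr.
  rewrite !big_split /= -!mulr_suml -!mulr_sumr sw mulr1.
  under [X in _ + X + _]eq_bigr do rewrite -mulrA.
  rewrite -mulr_sumr; over.
rewrite !big_split /= -!mulr_suml sw !mul1r.
rewrite (probE p (fun G => (m < #|G|)%N)).
have e G : `[< (m < #|G|)%N >] = (m < #|G|)%N by rewrite asboolb.
under [in leRHS]eq_bigr do rewrite e.
by rewrite mulr2n mulrDl mul1r.
Qed.

(** If [G] misses a member of the family, then an independent copy [T] meets
    that member in at least [k] elements with probability at least one half.
    In the pair [(G, T)] all the [k] elements are on the side of [T]. For a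
    fixed trace on [G :|: T] a random swap preserves this with probability at
    most [2 ^ - k], and there are at most [Phi] traces unless one of the two
    samples has more than [m] elements. *)
Lemma prob_net :
  prob p (fun G => exists2 S, family S & S :&: G = finset.set0) <=
  2 * (2 * prob p (fun G => (m < #|G|)%N) + Phi%:R / 2 ^+ k).
Proof.
rewrite -ler_pdivrMl //; apply: le_trans prob_missed.
rewrite probE mulr_sumr; apply: ler_sum => G _.
case: asboolP => [[S famS SG]|_]; last first.
  rewrite !mulr0; apply: sumr_ge0 => T _.
  by rewrite !mulr_ge0 ?weight_ge0.
rewrite mulr1; under eq_bigr do rewrite -mulrA.
rewrite -mulr_sumr mulrC ler_wpM2l ?weight_ge0 //.
have -> : 2^-1 = 1 - 2^-1 :> R by field.
rewrite lerBlDl; apply: le_trans (lerD (heavy famS) (lexx _)).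
rewrite probE -big_split /= -[X in X <= _](sum_weight E p).
apply: ler_sum => T _; rewrite -mulrDr ler_peMr ?weight_ge0 //.
rewrite asboolb -natrD ler1n.
case: (ltnP #|S :&: T| k) => // kT; rewrite asboolT //; by exists S.
Qed.

End NetLemma.

(** * Zero patterns of quadratic functions *)

Section ZeroPatterns.
Variables (F : fieldType) (U : Type) (k : nat) (y : U -> 'I_k.+1 -> F).
Variables (E : finType) (f : E -> U -> F) (X : {set E}).
Variable c : E -> 'I_k.+1 * 'I_k.+1 -> F.
Hypothesis y0 : forall u, y u ord0 = 1.
Hypothesis f_quadratic : forall e u,
  f e u = \sum_(ab : 'I_k.+1 * 'I_k.+1) c e ab * (y u ab.1 * y u ab.2).

Definition patterns : {set {set E}} :=
  [set Y | `[< exists u, Y = [set e in X | f e u != 0] >]].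

Let m := #|X|.
(* A monomial is a multiset of variables, represented by its sorted listing. *)
Let monomials : {set m.*2.-tuple 'I_k.+1} :=
  [set t : m.*2.-tuple 'I_k.+1 | sorted leq [seq \val i | i <- t]].

Let leI (i j : 'I_k.+1) := (i <= j)%N.

Let monomial_subproof (phi : {ffun 'I_m -> 'I_k.+1 * 'I_k.+1}) :
  size (sort leI ([seq (phi i).1 | i <- enum 'I_m] ++
                  [seq (phi i).2 | i <- enum 'I_m])) == m.*2.
Proof.
by rewrite size_sort size_cat !size_map -!enumT !size_enum_ord addnn.
Qed.

Let monomial phi : m.*2.-tuple 'I_k.+1 := Tuple (monomial_subproof phi).

Let monomial_sorted phi : monomial phi \in monomials.
Proof.
rewrite inE /= sorted_map; apply: sort_sorted => i j; exact: leq_total.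
Qed.

Let value (u : U) (t : m.*2.-tuple 'I_k.+1) := \prod_(a <- t) y u a.

Let value_monomial u phi :
  value u (monomial phi) = \prod_(i < m) (y u (phi i).1 * y u (phi i).2).
Proof.
rewrite /value /= (perm_big _ (permEl (perm_sort _ _))) big_cat /= !big_map.
by rewrite big_split /= -!enumT !big_enum.
Qed.

(* Off [Y] the coefficients are those of the constant [y u ord0 * y u ord0],
   that is [1], so that all the products have the same degree [2 m]. *)
Let coef (Y : {set E}) (e : E) (ab : 'I_k.+1 * 'I_k.+1) : F :=
  if e \in Y then c e ab else (ab == (ord0, ord0))%:R.

Let coefE Y e u :
  \sum_(ab : 'I_k.+1 * 'I_k.+1) coef Y e ab * (y u ab.1 * y u ab.2) =
  if e \in Y then f e u else 1.
Proof.
rewrite /coef; case: ifP => _; first by rewrite f_quadratic.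
rewrite (bigD1 (ord0, ord0)) //= !y0 !mulr1 big1 ?addr0 // => ab.
by move/negbTE ->; rewrite mul0r.
Qed.

Let prod_coef (Y : {set E}) u : Y \subset X ->
  \prod_(e in Y) f e u =
  \sum_(t in monomials)
    (\sum_(phi : {ffun 'I_m -> 'I_k.+1 * 'I_k.+1} | monomial phi == t)
       \prod_(i < m) coef Y (enum_val i) (phi i)) * value u t.
Proof.
move=> YX.
have -> : \prod_(e in Y) f e u = \prod_(e in X) (if e \in Y then f e u else 1).
  rewrite -big_mkcondr /=; apply: eq_bigl => e.
  by case: (boolP (e \in Y)) => [/(fintype.subsetP YX) ->|_]; rewrite ?andbF.
rewrite big_enum_val /=.
under eq_bigr do rewrite -coefE.
rewrite bigA_distr_bigA /=.
rewrite (partition_big monomial (mem monomials)) => [|phi _]; last first.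
  exact: monomial_sorted.
apply: eq_bigr => t _; rewrite big_distrl /=; apply: eq_bigr => phi /eqP <-.
by rewrite big_split /= value_monomial.
Qed.

(** For each pattern [Y], realised at a point [u_Y], consider the product of
    the [f e] over [e] in [Y]. It is nonzero at [u_Z] exactly when [Y] is a
    subset of [Z]; this matrix is triangular for inclusion with nonzero
    diagonal, so the products are linearly independent. They are forms of
    degree [2 * #|X|] in [k.+1] variables, which bounds their number. *)
Lemma card_patterns : (#|patterns| <= 'C(m.*2 + k, k))%N.
Proof.
have witness (i : 'I_#|patterns|) :
    {u | enum_val i = [set e in X | f e u != 0]}.
  apply: cid; have := enum_valP i; rewrite inE => /asboolP[u ->].
  by exists u.
pose u i := projT1 (witness i).
have uE i : enum_val i = [set e in X | f e (u i) != 0] := projT2 (witness i).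
pose A := \matrix_(i < #|patterns|, j < #|patterns|)
  \prod_(e in enum_val i) f e (u j).
have A_neq0 i j : (A i j != 0) = (enum_val i \subset enum_val j).
  rewrite mxE; apply/prodf_neq0/fintype.subsetP => H e ei.
    have := ei; rewrite uE [in X in _ -> X]uE !inE => /andP[-> _] /=.
    exact: H.
  by have := H e ei; rewrite uE inE => /andP[].
have A_free : row_free A.
  apply: inj_row_free => v vA0; apply/eqP/contraT => v_neq0.
  have [i0 vi0] : exists i, v 0 i != 0.
    apply/existsP; apply: contraNT v_neq0.
    rewrite negb_exists => /forallP v0; apply/eqP/rowP => i.
    by have /negPn/eqP -> := v0 i; rewrite mxE.
  (* An inclusion-minimal pattern with a nonzero coefficient isolates a
     single diagonal term of the vanishing combination. *)
  case: (arg_minnP (P := fun i => v 0 i != 0)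
    (fun i : 'I_#|patterns| => #|(enum_val i : {set E})|) vi0) => i vi min_i.
  have := congr1 (fun w : 'rV_ _ => w 0 i) vA0.
  rewrite mxE [RHS]mxE (bigD1 i) //= big1 ?addr0.
    by move/eqP; rewrite mulf_eq0 (negbTE vi) -[_ == 0]negbK A_neq0 subxx.
  move=> j ji; apply/eqP; rewrite mulf_eq0.
  case: eqP => //= /eqP vj; rewrite -[_ == 0]negbK A_neq0.
  apply: contra ji => sub; apply/eqP/enum_val_inj/eqP.
  by rewrite eqEcard sub min_i.
have -> : 'C(m.*2 + k, k) = #|monomials|.
  rewrite card_sorted_tuples -[LHS]bin_sub ?leq_addl //.
  by rewrite addnK.
pose Cf := \matrix_(i < #|patterns|, t < #|monomials|)
  \sum_(phi : {ffun 'I_m -> 'I_k.+1 * 'I_k.+1} | monomial phi == enum_val t)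
     \prod_(l < m) coef (enum_val i) (enum_val l) (phi l).
pose Mon := \matrix_(t < #|monomials|, j < #|patterns|)
  value (u j) (enum_val t).
have AE : A = Cf *m Mon.
  apply/matrixP => i j; rewrite !mxE prod_coef; last first.
    by rewrite uE; apply/fintype.subsetP => e; rewrite inE => /andP[].
  by rewrite big_enum_val /=; apply: eq_bigr => t _; rewrite !mxE.
move: A_free; rewrite /row_free AE => /eqP <-.
by apply: leq_trans (mxrankM_maxl _ _) (rank_leq_col _).
Qed.

End ZeroPatterns.

(** * Low-rank matrices with few nonzero entries *)

Section LowRank.
Variables (F : fieldType) (n : nat) (A : 'M[F]_n).

(** Call a row light if it has at most [theta] nonzero entries; few rows are
    heavy. The light rows are combinations of at most [D] of them, and outside
    the at most [D * theta] columns where these are nonzero all the light rows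
    vanish. *)
Lemma low_rank_zero_block (D theta : nat) :
  (\rank A <= D)%N ->
  exists2 T : {set 'I_n}, {in T &, forall i j, A i j = 0} &
    ((n - #|T|) * theta.+1 <=
      #|[set ij : 'I_n * 'I_n | A ij.1 ij.2 != 0%R]| + D * theta * theta.+1)%N.
Proof.
move=> rkA; pose deg i := #|[set j | A i j != 0]|.
pose S0 := [set i | (deg i <= theta)%N].
pose A0 := \matrix_(i < n) (if i \in S0 then row i A else 0).
have rkA0 : (\rank A0 <= D)%N.
  apply: leq_trans rkA; apply: mxrankS; apply/row_subP => i.
  by rewrite rowK; case: ifP => _; rewrite ?row_sub ?sub0mx.
pose g := maxrankfun A0.
pose bad := \bigcup_(i < \rank A0 | g i \in S0) [set j | A (g i) j != 0].
exists (S0 :\: bad).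
  move=> i j; rewrite !inE => /andP[_ iS0] /andP[jbad _].
  have : (row i A <= rowsub g A0)%MS.
    rewrite eq_maxrowsub; have -> : row i A = row i A0 by rewrite rowK inE iS0.
    exact: row_sub.
  case/submxP => w /(congr1 (fun r : 'rV_n => r 0 j)).
  rewrite !mxE => ->; apply: big1 => l _; rewrite !mxE.
  case: ifPn => gl; last by rewrite mxE mulr0.
  rewrite mxE; have [->|Alj] := eqVneq (A (g l) j) 0; first by rewrite mulr0.
  case/negP: jbad; apply/bigcupP; exists l => //; by rewrite inE.
have bad_card : (#|bad| <= D * theta)%N.
  rewrite /bad; apply: (@leq_trans (\sum_(i < \rank A0) theta)); last first.
    by rewrite sum_nat_const card_ord leq_mul2r rkA0 orbT.
  rewrite big_mkcond /=; elim/big_rec2: _ => [|i a b _ le_ba].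
    by rewrite cards0.
  apply: leq_trans (leq_card_setU _ _) _; apply: leq_add => //.
  by case: ifP; rewrite ?cards0 // inE.
have S0C : (#|~: S0| * theta.+1 <=
    #|[set ij : 'I_n * 'I_n | A ij.1 ij.2 != 0%R]|)%N.
  apply: (@leq_trans (\sum_(i in ~: S0) deg i)).
    rewrite -sum_nat_const; apply: leq_sum => i.
    by rewrite !inE -ltnNge.
  apply: (@leq_trans (\sum_(i < n) deg i)).
    by rewrite [leqRHS](bigID (mem (~: S0))) leq_addr.
  rewrite /deg; under eq_bigr do rewrite -sum1_card.
  rewrite pair_big_dep /= sum1_card; apply: subset_leq_card.
  apply/fintype.subsetP => -[i j] Aij.
  by have : j \in [set j | A i j != 0] := Aij; rewrite !inE.
have : (n - #|S0 :\: bad| <= #|~: S0| + #|bad|)%N.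
  rewrite -[X in (X - _)%N]card_ord -(cardsC (S0 :\: bad)) addKn.
  apply: leq_trans (leq_card_setU _ _); apply: subset_leq_card.
  apply/fintype.subsetP => i; rewrite !inE.
  by case: (i \in bad); case: (_ <= _)%N.
rewrite -(leq_pmul2r (isT : (0 < theta.+1)%N)) => /leq_trans; apply.
by rewrite mulnDl leq_add // leq_mul2r bad_card orbT.
Qed.

End LowRank.

(** * Distances, isometries and hyperplanes *)

Lemma row_free_neq0 (F : fieldType) (m n : nat) (A : 'M[F]_(m, n)) i :
  row_free A -> row i A != 0.
Proof.
apply: contraL => /eqP Ai0; apply/row_freePn; exists i; rewrite Ai0.
exact: sub0mx.
Qed.

Section Geometry.
Variables (R : realType) (d : nat).
Implicit Types x y z : 'rV[R]_d.

Definition dot x y : R := (x *m y^T) 0 0.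

Lemma dotE x y : dot x y = \sum_k x 0 k * y 0 k.
Proof. by rewrite /dot mxE; apply: eq_bigr => k _; rewrite mxE. Qed.

Lemma dotC x y : dot x y = dot y x.
Proof. by rewrite !dotE; apply: eq_bigr => k _; rewrite mulrC. Qed.

Lemma dotBl x y z : dot (x - y) z = dot x z - dot y z.
Proof. by rewrite /dot mulmxBl !mxE. Qed.

Lemma dotBr x y z : dot x (y - z) = dot x y - dot x z.
Proof. by rewrite dotC dotBl !(dotC x). Qed.

Lemma dot_eq0 x : (dot x x == 0) = (x == 0).
Proof.
apply/eqP/eqP => [|->]; last first.
  by rewrite dotE big1 // => k _; rewrite mxE mul0r.
rewrite dotE => /eqP; rewrite psumr_eq0 => [/allP x0|k _]; last first.
  by rewrite -expr2 sqr_ge0.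
apply/rowP => k; rewrite mxE; apply/eqP.
by have := x0 k; rewrite mem_index_enum mulf_eq0 orbb => /(_ isT).
Qed.

Definition sqdist x y : R := dot (x - y) (x - y).

Lemma sqdistE x y : sqdist x y = dot x x + dot y y - 2 * dot x y.
Proof. by rewrite /sqdist dotBl !dotBr (dotC y x); ring. Qed.

Lemma eq_edist x y x' y' :
  Defs.edist x y = Defs.edist x' y' <-> sqdist x y = sqdist x' y'.
Proof.
have edistE z z' : Defs.edist z z' = Num.sqrt (sqdist z z').
  rewrite /Defs.edist /sqdist dotE; congr Num.sqrt; apply: eq_bigr => k _.
  by rewrite !mxE expr2.
have sq_ge0 z z' : 0 <= sqdist z z'.
  by rewrite /sqdist dotE; apply: sumr_ge0 => k _; rewrite -expr2 sqr_ge0.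
rewrite !edistE; split=> [|->//] /eqP.
by rewrite eqr_sqrt ?sq_ge0 // => /eqP.
Qed.

Variable n : nat.
Implicit Types (u v : 'I_n -> 'rV[R]_d) (S T : {set 'I_n}).

(** After a translation the two families have the same Gram matrix. If [B]
    consists of [d] independent rows of the second family and [A] of the
    corresponding rows of the first, then [A *m A^T = B *m B^T] makes
    [invmx A *m B] orthogonal, and this matrix maps one family to the
    other. *)
Lemma isometry_extension u v T : affinely_spans v T ->
  {in T &, forall i j, sqdist (u i) (u j) = sqdist (v i) (v j)} ->
  exists2 Phi : 'rV[R]_d -> 'rV[R]_d, euclidean_isometry Phi &
    {in T, forall i, Phi (u i) = v i}.
Proof.
move=> vT uvT.
(* The empty set spans nothing, since the coefficients must sum to one. *)
have [i0 i0T] : exists i, i \in T.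
  have [c [+ _]] := vT 0; case: (set_0Vmem T) => [->|[i iT]]; last by exists i.
  by rewrite big_set0 => /eqP; rewrite eq_sym oner_eq0.
pose a i := u i - u i0; pose b i := v i - v i0.
have gram : {in T &, forall i j, dot (a i) (a j) = dot (b i) (b j)}.
  move=> i j iT jT; rewrite /a /b !dotBl !dotBr.
  have := uvT i j iT jT; have := uvT i i0 iT i0T; have := uvT j i0 jT i0T.
  rewrite !sqdistE (dotC (u i0) (u j)) (dotC (v i0) (v j)).
  lra.
pose M := \matrix_(i < n) (if i \in T then b i else 0).
have M_full : row_full M.
  rewrite -sub1mx; apply/row_subP => k.
  have [c [c1 cx]] := vT (row k 1%:M + v i0).
  have -> : row k 1%:M = (\row_i c i) *m M :> 'rV[R]_d.
    rewrite mulmx_sum_row (bigID (mem T)) /= [X in _ + X]big1 ?addr0.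
      under eq_bigr => i iT do rewrite mxE rowK iT scalerBr.
      by rewrite sumrB -scaler_suml c1 scale1r cx addrK.
    by move=> i /negbTE iT; rewrite rowK iT scaler0.
  exact: submxMl.
pose f := fullrankfun M_full.
pose B := rowsub f M.
have B_unit : B \in unitmx by apply: fullrowsub_unit.
have fT i : f i \in T.
  have := B_unit; rewrite -row_free_unit => /(row_free_neq0 i).
  apply: contraR => /negbTE fiT; apply/eqP/rowP => k.
  by rewrite !mxE fiT mxE.
pose A := \matrix_(i < d) a (f i).
have rowB i : row i B = b (f i).
  by rewrite row_rowsub rowK fT.
have mulE (x : 'rV[R]_d) (C : 'M[R]_d) i : (x *m C^T) 0 i = dot x (row i C).
  by rewrite dotE mxE; apply: eq_bigr => k _; rewrite !mxE.
have AB : A *m A^T = B *m B^T.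
  apply/row_matrixP => i; apply/rowP => j.
  by rewrite !row_mul !mulE rowB !rowK rowB gram ?fT.
have A_unit : A \in unitmx.
  move: B_unit; rewrite !unitmxE !unitfE => detB.
  have := congr1 determinant AB; rewrite !det_mulmx !det_tr => detAB.
  by apply: contraNneq detB => A0; move/eqP: detAB; rewrite A0 mul0r eq_sym
    mulf_eq0 orbb.
pose Q := invmx A *m B.
have QQ : Q *m Q^T = 1%:M.
  rewrite /Q trmx_mul mulmxA -(mulmxA _ B) -AB !mulmxA mulVmx // mul1mx.
  by rewrite -trmx_mul mulVmx ?trmx1.
have aQ i : i \in T -> a i *m Q = b i.
  move=> iT; apply: (can_inj (mulmxK (_ : B^T \in unitmx))).
    by rewrite unitmx_tr.
  rewrite -mulmxA -(mulmxA _ B) -AB (mulKmx A_unit).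
  by apply/rowP => j; rewrite !mulE rowB rowK gram ?fT.
have Q_unit : Q \in unitmx by have [] := mulmx1_unit QQ.
exists (fun x => (x - u i0) *m Q + v i0); last first.
  by move=> i iT; rewrite aQ // subrK.
split.
  exists (fun x => (x - v i0) *m invmx Q + u i0) => x.
    by rewrite addrK (mulmxK Q_unit) subrK.
  by rewrite addrK (mulmxKV Q_unit) subrK.
move=> x y; apply/eq_edist; rewrite /sqdist.
have -> : (x - u i0) *m Q + v i0 - ((y - u i0) *m Q + v i0) = (x - y) *m Q.
  by rewrite opprD addrACA subrr addr0 -mulmxBl opprB addrA subrK.
by rewrite /dot trmx_mul mulmxA -(mulmxA _ Q) QQ mulmx1.
Qed.

Lemma hyperplane_not_spanning v S (a : 'rV[R]_d) (c : R) : a != 0 ->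
  {in S, forall i, dot a (v i) = c} -> ~ affinely_spans v S.
Proof.
move=> a0 vS span.
have dotac x : dot a x = c.
  have [l [l1 <-]] := span x.
  have -> : dot a (\sum_(i in S) l i *: v i) = \sum_(i in S) l i * dot a (v i).
    rewrite /dot linear_sum mulmx_sumr summxE; apply: eq_bigr => i _.
    by rewrite linearZ /= -scalemxAr mxE.
  rewrite (eq_bigr (fun i => l i * c)) => [|i iS]; last by rewrite vS.
  by rewrite -mulr_suml l1 mul1r.
case/negP: a0; rewrite -dot_eq0 dotac -(dotac 0).
by rewrite /dot trmx0 mulmx0 mxE.
Qed.

Lemma bisector x y z : sqdist x z = sqdist y z ->
  dot (y - x) z = (dot y y - dot x x) / 2.
Proof. by rewrite !sqdistE dotBl; lra. Qed.

(** Affine dependence among the points is linear dependence among the rows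
    [(v i, 1)]; the rows outside [S] are zeroed so that the row space is the
    span of the lifted points of [S]. *)
Definition lifts v S : 'M[R]_(n, d + 1) :=
  \matrix_(i < n) (if i \in S then row_mx (v i) (1%:M : 'M[R]_1) else 0).

Definition flat v S : {set 'I_n} :=
  [set i | (row_mx (v i) (1%:M : 'M[R]_1) <= lifts v S)%MS].

Lemma flat_hyperplane v S (a : 'rV[R]_d) (c : R) :
  {in S, forall i, dot a (v i) = c} -> {in flat v S, forall i, dot a (v i) = c}.
Proof.
move=> aS; pose h : 'cV[R]_(d + 1) := col_mx a^T (- c%:M).
have hE i : row_mx (v i) 1%:M *m h = (dot a (v i) - c)%:M.
  rewrite mul_row_col mul1mx dotC /dot; apply/rowP => j; rewrite !ord1 !mxE.
  by rewrite eqxx !mulr1n.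
have hS : lifts v S *m h = 0.
  apply/row_matrixP => i; rewrite row_mul rowK row0; case: ifP => iS.
    by rewrite hE aS // subrr raddf0.
  by rewrite mul0mx.
move=> i; rewrite inE => /submxP[D /(congr1 (fun A => A *m h))].
rewrite hE -mulmxA hS mulmx0 => /(congr1 (fun A : 'M[R]_1 => A 0 0)).
by rewrite !mxE eqxx mulr1n => /eqP; rewrite subr_eq0 => /eqP.
Qed.

(** The lifted points of [S] are killed by a nonzero functional of a space of
    dimension [d + 1], so at most [d] of them already span the others. *)
Lemma hyperplane_basis v S (a : 'rV[R]_d) (c : R) : a != 0 ->
  {in S, forall i, dot a (v i) = c} ->
  exists B : {set 'I_n}, [/\ B \subset S, (#|B| <= d)%N & S \subset flat v B].
Proof.
move=> a0 aS.
pose g := maxrankfun (lifts v S).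
have gS l : g l \in S.
  have : row_free (rowsub g (lifts v S)) by apply: maxrowsub_free.
  move/(row_free_neq0 l); apply: contraR => /negbTE glS.
  by apply/eqP/rowP => k; rewrite !mxE glS mxE.
exists (g @: 'I_(\rank (lifts v S))); split.
- by apply/fintype.subsetP => _ /imsetP[l _ ->].
- apply: leq_trans (leq_imset_card _ _) _; rewrite card_ord.
  pose h : 'cV[R]_(d + 1) := col_mx a^T (- c%:M).
  have hS : lifts v S *m h = 0.
    apply/row_matrixP => i; rewrite row_mul rowK row0; case: ifP => iS.
      rewrite mul_row_col mul1mx; apply/rowP => j; rewrite !ord1.
      have := aS i iS; rewrite dotC /dot !mxE eqxx mulr1n => ->.
      by rewrite subrr.
    by rewrite mul0mx.
  have h_rank : \rank h = 1%N.
    apply/eqP; rewrite eqn_leq rank_leq_col lt0n mxrank_eq0.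
    apply: contraNneq a0 => h0; rewrite -trmx_eq0.
    by rewrite -(col_mxKu a^T (- c%:M)) -/h h0 linear0.
  have : (lifts v S <= kermx h)%MS by apply/sub_kermxP.
  by move/mxrankS; rewrite mxrank_ker h_rank addnK.
- apply/fintype.subsetP => i iS; rewrite inE.
  apply: (submx_trans (B := lifts v S)).
    have -> : row_mx (v i) 1%:M = row i (lifts v S) by rewrite rowK iS.
    exact: row_sub.
  rewrite -(eq_maxrowsub (lifts v S)) -/g; apply/row_subP => l.
  have -> : row l (rowsub g (lifts v S)) =
      row (g l) (lifts v (g @: 'I_(\rank (lifts v S)))).
    by rewrite row_rowsub !rowK gS imset_f.
  exact: row_sub.
Qed.

End Geometry.

(** * Mismatched pairs *)

Section Gap.
Variables (R : realType) (d n : nat).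
Implicit Types (u v : 'I_n -> 'rV[R]_d) (W T B : {set 'I_n}).
Implicit Types (G : {set pair_of n}) (e : pair_of n).

Definition gap v u i j : R := sqdist (u i) (u j) - sqdist (v i) (v j).

(** Summing over all ordered pairs from [e] avoids choosing an order of its two
    elements; by symmetry the sum is twice the gap. *)
Definition mismatch v u : {set pair_of n} :=
  [set e : pair_of n |
    \sum_(i in (val e : {set 'I_n})) \sum_(j in (val e : {set 'I_n}))
      gap v u i j != 0].

Lemma gapC v u i j : gap v u i j = gap v u j i.
Proof. by rewrite /gap !sqdistE (dotC (u i)) (dotC (v i)); ring. Qed.

Lemma gap_diag v u i : gap v u i i = 0.
Proof. by rewrite /gap !sqdistE; ring. Qed.

Lemma mem_mismatch v u e i j : val e = [set i; j] ->
  (e \in mismatch v u) = (gap v u i j != 0).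
Proof.
move=> eij; rewrite inE eij.
have ij : i != j.
  by have := valP e; rewrite eij cards2; case: (i != j).
have set2 (f : 'I_n -> R) : \sum_(l in [set i; j]) f l = f i + f j.
  by rewrite big_setU1 ?inE // big_set1.
rewrite !set2 !gap_diag (gapC v u j i) addr0 add0r -mulr2n mulrn_eq0.
by rewrite negb_or.
Qed.

Lemma same_revealed_mismatch v u G :
  same_revealed_dist G u v -> mismatch v u :&: G = finset.set0.
Proof.
move=> uvG; apply/setP => e; rewrite !finset.in_setI finset.in_set0; apply/negP.
case/andP=> + eG; have /cards2P[i [j [_ eij]]] := valP e.
rewrite (mem_mismatch _ _ eij) /gap subr_eq0 => /eqP; apply.
by apply/eq_edist; apply: uvG eG eij.
Qed.

(** A mismatched pair [e] contributes at most [#|setX e e| = 4] entries. *)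
Lemma card_gap v u :
  (#|[set ij : 'I_n * 'I_n | gap v u ij.1 ij.2 != 0%R]|
     <= 4 * #|mismatch v u|)%N.
Proof.
apply: (@leq_trans #|\bigcup_(e in mismatch v u) finset.setX (val e) (val e)|).
  apply: subset_leq_card; apply/fintype.subsetP => -[i j].
  rewrite inE /= => gij.
  have ij : i != j by apply: contraNneq gij => ->; rewrite gap_diag.
  have c2 : #|[set i; j]| == 2%N by rewrite cards2 ij.
  apply/bigcupP; exists (exist _ [set i; j] c2 : pair_of n).
    by rewrite (@mem_mismatch _ _ _ i j).
  by rewrite !inE /= !eqxx orbT.
rewrite mulnC -sum_nat_const.
elim/big_rec2: _ => [|e a b _ le_ba]; first by rewrite cards0.
apply: leq_trans (leq_card_setU _ _) _; apply: leq_add => //.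
by rewrite cardsX (eqP (valP e)).
Qed.

(** The squared norms contribute two matrices of rank one, and the inner
    products of [u] and of [v] two Gram matrices of rank at most [d]. *)
Lemma rank_gap v u : (\rank (\matrix_(i, j) gap v u i j) <= 2 + 2 * d)%N.
Proof.
pose al := \col_(i < n) (dot (u i) (u i) - dot (v i) (v i)).
pose ones := const_mx 1 : 'cV[R]_n.
pose Um := \matrix_(i < n) u i; pose Vm := \matrix_(i < n) v i.
have dotm (x : 'I_n -> 'rV[R]_d) i j :
    ((\matrix_(i < n) x i) *m (\matrix_(i < n) x i)^T) i j = dot (x i) (x j).
  by rewrite dotE mxE; apply: eq_bigr => k _; rewrite !mxE.
have -> : \matrix_(i, j) gap v u i j =
    (al *m ones^T + ones *m al^T) + (Um *m (- 2 *: Um^T) + Vm *m (2 *: Vm^T)).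
  apply/matrixP => i j; rewrite -!scalemxAr [RHS]mxE [X in _ = X + _]mxE.
  rewrite [X in _ = _ + X]mxE [X in _ = _ + (X + _)]mxE.
  rewrite [X in _ = _ + (_ + X)]mxE !dotm !mxE !big_ord1 !mxE.
  by rewrite /gap !sqdistE; ring.
have rk m (A : 'M[R]_(n, m)) (B : 'M[R]_(m, n)) : (\rank (A *m B) <= m)%N.
  exact: leq_trans (mxrankM_maxl _ _) (rank_leq_col _).
apply: leq_trans (mxrank_add _ _) _; rewrite mul2n -addnn.
apply: leq_add; apply: leq_trans (mxrank_add _ _) _; last exact: leq_add.
exact: (@leq_add _ _ 1 1).
Qed.

Lemma large_congruent_subset v u theta :
  exists2 T : {set 'I_n},
    {in T &, forall i j, sqdist (u i) (u j) = sqdist (v i) (v j)} &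
    ((n - #|T|) * theta.+1 <=
      4 * #|mismatch v u| + (2 + 2 * d) * theta * theta.+1)%N.
Proof.
have [T T0 Tcard] := low_rank_zero_block theta (rank_gap v u).
exists T.
  by move=> i j iT jT; have := T0 i j iT jT; rewrite mxE => /subr0_eq.
apply: leq_trans Tcard _; rewrite leq_add2r; apply: leq_trans (card_gap v u).
by apply: subset_leq_card; apply/fintype.subsetP => ij; rewrite !inE mxE.
Qed.

(** The constant [1] at [ord0] homogenizes: quadratic functions become
    quadratic forms in the coordinates. *)
Definition coordinates u (a : 'I_#|{: 'I_n * 'I_d}|.+1) : R :=
  if unlift ord0 a is Some b then u (enum_val b).1 0 (enum_val b).2 else 1.

Definition quadratic (f : ('I_n -> 'rV[R]_d) -> R) :=
  exists c : 'I_#|{: 'I_n * 'I_d}|.+1 * 'I_#|{: 'I_n * 'I_d}|.+1 -> R,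
  forall u, f u = \sum_ab c ab * (coordinates u ab.1 * coordinates u ab.2).

Lemma quadraticD f g :
  quadratic f -> quadratic g -> quadratic (fun u => f u + g u).
Proof.
move=> [c cE] [c' c'E]; exists (fun ab => c ab + c' ab) => u.
by rewrite cE c'E -big_split; apply: eq_bigr => ab _; rewrite mulrDl.
Qed.

Lemma quadraticZ (x : R) f : quadratic f -> quadratic (fun u => x * f u).
Proof.
move=> [c cE]; exists (fun ab => x * c ab) => u.
by rewrite cE mulr_sumr; apply: eq_bigr => ab _; rewrite mulrA.
Qed.

Lemma quadratic_monomial a b :
  quadratic (fun u => coordinates u a * coordinates u b).
Proof.
exists (fun ab => (ab == (a, b))%:R) => u.
rewrite (bigD1 (a, b)) //= eqxx mul1r big1 ?addr0 // => ab /negbTE ->.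
by rewrite mul0r.
Qed.

Lemma eq_quadratic f g : f =1 g -> quadratic f -> quadratic g.
Proof. by move=> fg [c cE]; exists c => u; rewrite -fg. Qed.

Lemma quadratic_const x : quadratic (fun=> x).
Proof.
apply: eq_quadratic (quadraticZ x (quadratic_monomial ord0 ord0)) => u.
by rewrite /coordinates unlift_none !mulr1.
Qed.

Lemma quadratic_sum (I : Type) (r : seq I) (P : pred I) f :
  (forall i, quadratic (f i)) -> quadratic (fun u => \sum_(i <- r | P i) f i u).
Proof.
move=> fq; elim: r => [|i r IH].
  by apply: eq_quadratic (quadratic_const 0) => u; rewrite big_nil.
case Pi: (P i).
  by apply: eq_quadratic (quadraticD (fq i) IH) => u; rewrite big_cons Pi.
by apply: eq_quadratic IH => u; rewrite big_cons Pi.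
Qed.

Lemma quadratic_gap v i j : quadratic (fun u => gap v u i j).
Proof.
have coordE u l k :
    coordinates u (lift ord0 (enum_rank (l, k))) = u l 0 k.
  by rewrite /coordinates liftK enum_rankK.
have dotq l l' : quadratic (fun u => dot (u l) (u l')).
  apply: (eq_quadratic (f := fun u => \sum_k u l 0 k * u l' 0 k)).
    by move=> u; rewrite dotE.
  apply: quadratic_sum => k.
  apply: eq_quadratic (quadratic_monomial (lift ord0 (enum_rank (l, k)))
    (lift ord0 (enum_rank (l', k)))) => u.
  by rewrite !coordE.
apply: (eq_quadratic (f := fun u => (dot (u i) (u i) + dot (u j) (u j)) +
    ((- 2) * dot (u i) (u j) + - sqdist (v i) (v j)))).
  by move=> u; rewrite /gap (sqdistE (u i)); ring.
apply: quadraticD; first exact: quadraticD.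
by apply: quadraticD; [exact: quadraticZ | exact: quadratic_const].
Qed.

Lemma card_traces_mismatch v (family : {set pair_of n} -> Prop)
    (X : {set pair_of n}) :
  (forall S, family S -> exists u, S = mismatch v u) ->
  (#|traces family X| <= 'C(#|X|.*2 + n * d, n * d))%N.
Proof.
move=> family_mismatch.
have -> : (n * d = #|{: 'I_n * 'I_d}|)%N by rewrite card_prod !card_ord.
pose f e u := \sum_(i in (val e : {set 'I_n}))
  \sum_(j in (val e : {set 'I_n})) gap v u i j.
have fq e : quadratic (f e).
  by do 2![apply: quadratic_sum => ?]; exact: quadratic_gap.
pose c e := projT1 (cid (fq e)).
have fE e u : f e u = \sum_ab c e ab *
    (coordinates u ab.1 * coordinates u ab.2) := projT2 (cid (fq e)) u.
have y0 u : coordinates u ord0 = 1 by rewrite /coordinates unlift_none.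
apply: leq_trans (card_patterns X y0 fE).
apply: subset_leq_card; apply/fintype.subsetP => Y.
rewrite !inE => -[S /family_mismatch[u ->] ->].
exists u; apply/setP => e; rewrite finset.in_setI !finset.in_set.
by rewrite andbC.
Qed.

End Gap.

(** * Stray points *)

Section PairsOf.
Variables (n : nat).
Implicit Types (D : {set 'I_n * 'I_n}) (W : {set 'I_n}) (e : pair_of n).

(** The pairs underlying a set of ordered pairs. Those that go from [W] to its
    complement are oriented by [W], hence counted without loss. *)
Definition pairs_of D : {set pair_of n} :=
  [set e | [exists x in D, val e == [set x.1; x.2]]].

Definition crossing W D := forall x, x \in D -> (x.1 \in W) && (x.2 \notin W).

Lemma set2_crossing W (x y : 'I_n * 'I_n) :
  (x.1 \in W) && (x.2 \notin W) -> (y.1 \in W) && (y.2 \notin W) ->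
  [set x.1; x.2] = [set y.1; y.2] -> x = y.
Proof.
case: x y => [i j] [i' j'] /= /andP[iW jW] /andP[i'W j'W] eqs.
have := set21 i j; rewrite eqs !inE => /orP[/eqP ii'|/eqP ij']; last first.
  by case/negP: j'W; rewrite -ij'.
have := set22 i j; rewrite eqs !inE => /orP[/eqP ji'|/eqP jj']; last first.
  by rewrite ii' jj'.
by case/negP: jW; rewrite ji'.
Qed.

Lemma card_pairs_of W D : crossing W D -> #|pairs_of D| = #|D|.
Proof.
move=> cD; rewrite -(card_imset _ val_inj).
rewrite -(card_in_imset (f := fun x : 'I_n * 'I_n => [set x.1; x.2]) (D := D)).
  congr #|pred_of_set _|; apply/setP => s; apply/imsetP/imsetP.
    move=> [e]; rewrite inE => /existsP[x /andP[xD /eqP ex]] ->.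
    by exists x.
  move=> [x xD ->]; have /andP[xW x'W] := cD x xD.
  have c2 : #|[set x.1; x.2]| == 2%N.
    rewrite cards2; have [x12|//] := eqVneq x.1 x.2.
    by move: x'W; rewrite -x12 xW.
  exists (exist _ [set x.1; x.2] c2 : pair_of n) => //.
  by rewrite inE; apply/existsP; exists x; rewrite xD /=.
by move=> x y xD yD /=; apply: (set2_crossing (cD x xD) (cD y yD)).
Qed.

Lemma disjoint_pairs_of W D D' : crossing W D -> crossing W D' ->
  [disjoint D & D'] -> [disjoint pairs_of D & pairs_of D'].
Proof.
move=> cD cD' DD'; apply/pred0P => e /=; rewrite !inE.
apply/negP => /andP[/existsP[x /andP[xD /eqP ex]]].
move=> /existsP[y /andP[yD' /eqP ey]].
have xy : x = y by apply: (set2_crossing (cD x xD) (cD' y yD')); rewrite -ex.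
by move: yD'; rewrite -xy (disjointFr DD' xD).
Qed.

End PairsOf.

Section Cut.
Variables (R : realType) (d n : nat) (v : 'I_n -> 'rV[R]_d).
Implicit Types (u : 'I_n -> 'rV[R]_d) (W T B S : {set 'I_n}).
Implicit Types (G : {set pair_of n}) (e : pair_of n).

Definition coplanar S :=
  exists a : 'rV[R]_d, exists c, a != 0 /\ {in S, forall i, dot a (v i) = c}.

Definition revealed_nbrs G (w : 'I_n) : {set 'I_n} :=
  [set j | [exists e in G, val e == [set w; j]]].

(** If [u] agrees with all revealed distances and differs from [v] exactly on
    [W], then the revealed neighbours outside [W] of a point [w] of [W] lie on
    the bisector of the two positions of [w], whence this condition. *)
Definition stray W G :=
  forall w, w \in W -> coplanar (revealed_nbrs G w :\: W).

Definition some_stray (s : nat) G :=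
  exists2 W : {set 'I_n}, (W != finset.set0) && (#|W| <= s)%N & stray W G.

Lemma stray_of_mismatch u T G : injective v -> affinely_spans v T ->
  {in T &, forall i j, sqdist (u i) (u j) = sqdist (v i) (v j)} ->
  mismatch v u :&: G = finset.set0 ->
  (exists2 Phi, euclidean_isometry Phi & forall i, Phi (u i) = v i) \/
  some_stray (n - #|T|) G.
Proof.
move=> v_inj vT uvT uvG; have [Phi [Phi_bij Phi_iso] PhiT] :=
  isometry_extension vT uvT.
pose W := [set i | Phi (u i) != v i].
have [W0|W0] := eqVneq W finset.set0.
  left; exists Phi => // i; apply/eqP/negPn.
  by have /setP/(_ i) := W0; rewrite !inE => ->.
right; exists W.
  rewrite W0 /= -[n in (n - _)%N]card_ord -(cardsC T) addKn.
  apply: subset_leq_card; apply/fintype.subsetP => i; rewrite !inE.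
  by apply: contraNN => iT; rewrite PhiT.
move=> w; rewrite inE => wW.
exists (v w - Phi (u w)).
exists ((dot (v w) (v w) - dot (Phi (u w)) (Phi (u w))) / 2).
split; first by rewrite subr_eq0 eq_sym.
move=> j; rewrite !inE negbK => /andP[/eqP jW /existsP[e /andP[eG /eqP ewj]]].
apply: bisector.
have : e \notin mismatch v u.
  apply/negP => emm; have /setP/(_ e) := uvG.
  by rewrite finset.in_setI finset.in_set0 emm eG.
rewrite (mem_mismatch _ _ ewj) negbK /gap subr_eq0 => /eqP <-.
rewrite -{1}jW; apply/eq_edist; exact: Phi_iso.
Qed.

Variables (p : R) (s h : nat).
Hypotheses (p_ge0 : 0 <= p) (p_le1 : p <= 1).
Hypothesis coplanar_card : forall S, coplanar S -> (#|S| <= h)%N.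

(** The cost of one stray point: at most [d] revealed neighbours spanning the
    flat, and no revealed pair to the at least [n - s - h] remaining points. *)
Definition stray_bound : R :=
  (\sum_(B : {set 'I_n} | (#|B| <= d)%N) p ^+ #|B|) * (1 - p) ^+ (n - s - h).

(* A union bound over the possible spanning sets of neighbours of all the
   points of [W]; the constraint [set0] off [W] makes the choices products. *)
Let choice_ok W (w : 'I_n) : pred {set 'I_n} := fun B =>
  if w \in W then [&& B \subset ~: W, (#|B| <= d)%N & (#|flat v B| <= h)%N]
  else B == finset.set0.

Let present W (beta : {ffun 'I_n -> {set 'I_n}}) :=
  [set x : 'I_n * 'I_n | (x.1 \in W) && (x.2 \in beta x.1)].

Let absent W (beta : {ffun 'I_n -> {set 'I_n}}) :=
  [set x : 'I_n * 'I_n |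
    (x.1 \in W) && (x.2 \in ~: W :\: flat v (beta x.1))].

Lemma subset_flat B : B \subset flat v B.
Proof.
apply/fintype.subsetP => i iB; rewrite inE.
have -> : row_mx (v i) 1%:M = row i (lifts v B) by rewrite rowK iB.
exact: row_sub.
Qed.

Let stray_witness W G : stray W G ->
  exists2 beta, beta \in family (choice_ok W) &
    pairs_of (present W beta) \subset G /\
    [disjoint pairs_of (absent W beta) & G].
Proof.
move=> strayW.
have /boolp.choice[beta betaP] : forall w, exists B : {set 'I_n}, w \in W ->
    [/\ choice_ok W w B, B \subset revealed_nbrs G w &
        revealed_nbrs G w :\: W \subset flat v B].
  move=> w; have [wW|] := boolP (w \in W); last by exists finset.set0.
  have [a [c [a0 ac]]] := strayW w wW.
  have [B [BN Bd NB]] := hyperplane_basis a0 ac.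
  exists B => _; split=> //.
    rewrite /choice_ok wW Bd; apply/andP; split.
      exact: fintype.subset_trans BN (subsetDr _ _).
    apply: coplanar_card; exists a, c; split=> //.
    by apply: flat_hyperplane => i /(fintype.subsetP BN); apply: ac.
  exact: fintype.subset_trans BN (subsetDl _ _).
exists [ffun w => if w \in W then beta w else finset.set0].
  apply/familyP => w; rewrite ffunE.
  change (choice_ok W w (if w \in W then beta w else finset.set0)).
  case: ifP => wW; first by have [] := betaP w wW.
  by rewrite /choice_ok wW.
split.
  apply/fintype.subsetP => e; rewrite inE => /existsP[x /andP[]].
  rewrite inE ffunE => /andP[xW]; rewrite xW => x2 /eqP ex.
  have [_ /fintype.subsetP/(_ _ x2) + _] := betaP _ xW.
  rewrite inE => /existsP[e' /andP[e'G /eqP e'x]].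
  by rewrite (_ : e = e') //; apply: val_inj; rewrite ex e'x.
apply/pred0P => e /=; apply/negP => /andP[+ eG].
rewrite inE => /existsP[x /andP[]].
rewrite inE ffunE => /andP[xW]; rewrite xW => x2 /eqP ex.
have [_ _ /fintype.subsetP/(_ x.2)] := betaP _ xW.
move: x2; rewrite !inE => /andP[x2 x2W]; rewrite x2W (negbTE x2) /=.
move=> imp; suff : false by [].
by apply: imp; apply/existsP; exists e; rewrite eG ex eqxx.
Qed.

Let prob_choice W beta : (#|W| <= s)%N -> beta \in family (choice_ok W) ->
  prob p (fun G => pairs_of (present W beta) \subset G /\
    [disjoint pairs_of (absent W beta) & G]) <=
  \prod_(w : 'I_n) (if w \in W then p ^+ #|beta w| * (1 - p) ^+ (n - s - h)
                    else 1).
Proof.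
move=> Ws /familyP beta_ok.
have ok w : w \in W ->
    [/\ beta w \subset ~: W, (#|beta w| <= d)%N & (#|flat v (beta w)| <= h)%N].
  move=> wW; have : choice_ok W w (beta w) := beta_ok w.
  by rewrite /choice_ok wW => /and3P[].
have c1 : crossing W (present W beta).
  move=> x; rewrite inE => /andP[xW x2]; rewrite xW.
  by have [/fintype.subsetP/(_ _ x2)] := ok _ xW; rewrite inE.
have c2 : crossing W (absent W beta).
  by move=> x; rewrite !inE => /andP[-> /andP[_ ->]].
rewrite prob_cylinder //; last first.
  apply: (disjoint_pairs_of c1 c2); apply/pred0P => x /=.
  apply/negP => /andP[]; rewrite inE => /andP[xW x2]; rewrite inE xW /=.
  by rewrite finset.in_setD (fintype.subsetP (subset_flat _) _ x2).
rewrite (card_pairs_of c1) (card_pairs_of c2).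
have card_rel (f : 'I_n -> {set 'I_n}) :
    #|[set x : 'I_n * 'I_n | (x.1 \in W) && (x.2 \in f x.1)]| =
    (\sum_(w in W) #|f w|)%N.
  under eq_bigr do rewrite -sum1_card.
  rewrite pair_big_dep /= sum1_card; apply: eq_card => -[i j].
  by rewrite inE.
rewrite (card_rel beta) (card_rel (fun w => ~: W :\: flat v (beta w))).
rewrite !expr_sum -big_split /= -big_mkcond /=.
apply: ler_prod => w wW; have [_ _ flat_h] := ok w wW.
rewrite mulr_ge0 ?exprn_ge0 ?subr_ge0 //=.
apply: ler_wpM2l; first exact: exprn_ge0.
apply: ler_wiXn2l; rewrite ?subr_ge0 ?gerBl //.
rewrite -[X in (X - s - h)%N]card_ord -subnDA leq_subLR.
rewrite -(cardsC W) -addnA leq_add // -(cardsID (flat v (beta w))) leq_add //.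
by apply: leq_trans flat_h; apply: subset_leq_card; apply: finset.subsetIr.
Qed.

Lemma stray_bound_ge0 : 0 <= stray_bound.
Proof.
rewrite mulr_ge0 ?exprn_ge0 ?subr_ge0 //.
by apply: sumr_ge0 => B _; apply: exprn_ge0.
Qed.

(** The pairs between [W] and its complement that concern different points of
    [W] are different, so the bounds for the points of [W] multiply. *)
Lemma prob_stray W : (#|W| <= s)%N -> prob p (stray W) <= stray_bound ^+ #|W|.
Proof.
move=> Ws.
apply: (@le_trans _ _ (\sum_(beta in family (choice_ok W))
    prob p (fun G => pairs_of (present W beta) \subset G /\
      [disjoint pairs_of (absent W beta) & G]))).
  apply: le_trans (prob_exists p_ge0 p_le1 _ _).
  by apply: prob_le => // G /stray_witness.
apply: (le_trans (ler_sum _ (fun beta => prob_choice Ws))).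
rewrite -(bigA_distr_big_dep _ (fun w B => if w \in W
  then p ^+ #|B| * (1 - p) ^+ (n - s - h) else 1)) /=.
rewrite -prodr_const [leRHS]big_mkcond /=; apply: ler_prod => w _.
rewrite /choice_ok; case: (w \in W).
  rewrite sumr_ge0 /=; last first.
    by move=> B _; rewrite mulr_ge0 ?exprn_ge0 ?subr_ge0.
  rewrite -mulr_suml ler_wpM2r ?exprn_ge0 ?subr_ge0 //.
  rewrite big_mkcond [leRHS]big_mkcond /=; apply: ler_sum => B _.
  case: ifP => [/and3P[_ -> _] //|_].
  by case: ifP => // _; apply: exprn_ge0.
by rewrite big_pred1_eq ler01 lexx.
Qed.

(** Sum over the nonempty [W] and recognise the binomial expansion. *)
Lemma prob_some_stray : prob p (some_stray s) <=
  (1 + stray_bound) ^+ n - 1.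
Proof.
apply: le_trans (prob_exists p_ge0 p_le1
  (fun W : {set 'I_n} => (W != finset.set0) && (#|W| <= s)%N) stray) _.
have -> : (1 + stray_bound) ^+ n = \sum_(W : {set 'I_n}) stray_bound ^+ #|W|.
  rewrite addrC -[n in LHS]card_ord -prodr_const bigA_distr /=.
  by apply: eq_bigr => W _; rewrite -prodr_const [RHS]big_mkcond.
rewrite [X in _ <= X - 1](bigD1 finset.set0) //= cards0 expr0.
rewrite [leRHS]addrC addKr.
rewrite big_mkcond [leRHS]big_mkcond /=; apply: ler_sum => W _.
case: ifP => [/andP[-> Ws]|_]; first exact: prob_stray.
by case: ifP => // _; rewrite exprn_ge0 ?stray_bound_ge0.
Qed.

End Cut.

(** * Quantitative estimates *)

Section Estimates.
Variable R : realType.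
Implicit Types (x y p : R).

Lemma bin_le_expn (n b : nat) : ('C(n, b) <= n ^ b)%N.
Proof.
elim: b => [|b IH]; first by rewrite bin0.
case: (leqP n b) => [nb|bn]; first by rewrite bin_small.
rewrite -(leq_pmul2l (isT : (0 < b.+1)%N)) mul_bin_left expnS.
apply: leq_trans (leq_mul (leq_subr b n) IH) _.
by rewrite leq_pmull.
Qed.

(** Keep one term of the expansion of [(1 + x) ^+ (a + b)]. With [x] a small
    constant and [a] of order [n * ln n], [b] of order [n], the exponent is a
    small multiple of [a] up to [O(n)]. *)
Lemma bin_le_expR (a b : nat) x : 0 < x ->
  ('C(a + b, b))%:R <= expR (x * (a + b)%:R + b%:R * - ln x).
Proof.
move=> x0; have xb : x ^+ b = expR (- (b%:R * - ln x)).
  by rewrite mulrN opprK expRM_natl lnK.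
rewrite expRD -[X in _ <= _ * X]invrK -expRN -xb ler_pdivlMr ?exprn_gt0 //.
apply: (@le_trans _ _ ((1 + x) ^+ (a + b))); last first.
  rewrite expRM_natr lerXn2r ?nnegrE ?expR_ge0 ?expR_ge1Dx //.
  by rewrite addr_ge0 ?ler01 // ltW.
rewrite exprDn (bigD1 (inord b)) //= inordK ?ltnS ?leq_addl //.
rewrite expr1n mul1r mulr_natl lerDl; apply: sumr_ge0 => i _.
by rewrite mulrn_wge0 ?mulr_ge0 ?exprn_ge0 ?(ltW x0).
Qed.

Lemma expR_half_le2 : expR (2^-1 : R) <= 2.
Proof.
rewrite -[leLHS]invrK -expRN invf_ple ?posrE ?expR_gt0 //.
by apply: le_trans (expR_ge1Dx _); lra.
Qed.

Lemma le2_expR1 : 2 <= expR (1 : R).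
Proof. by apply: le_trans (expR_ge1Dx _); lra. Qed.

Lemma exp2_ge (k : nat) : expR (k%:R / 2) <= 2 ^+ k :> R.
Proof.
rewrite expRM_natl lerXn2r ?nnegrE ?expR_ge0 //; exact: expR_half_le2.
Qed.

Lemma exp2_le (k : nat) : 2 ^+ k <= expR k%:R :> R.
Proof.
rewrite -[k%:R]mulr1 expRM_natl lerXn2r ?nnegrE ?expR_ge0 //; exact: le2_expR1.
Qed.

Lemma onem_exp_le p (N : nat) : p <= 1 -> (1 - p) ^+ N <= expR (- (p * N%:R)).
Proof.
move=> p1; rewrite -mulNr expRM_natr lerXn2r ?nnegrE ?expR_ge0 ?subr_ge0 //.
exact: expR_ge1Dx.
Qed.

Lemma expR_sub1_le x : 0 <= x -> x <= 2^-1 -> expR x - 1 <= 2 * x.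
Proof.
move=> x0 x2; rewrite lerBlDr -[leLHS]invrK -expRN.
have x1 : 0 < 1 - x by lra.
apply: (@le_trans _ _ (1 - x)^-1).
  by rewrite lef_pV2 ?posrE ?expR_gt0 //; apply: expR_ge1Dx.
by rewrite -[leLHS]mul1r ler_pdivrMr //; nra.
Qed.

Definition many_mismatches (d n : nat) (v : 'I_n -> 'rV[R]_d) (delta : R)
    (G : {set pair_of n}) :=
  exists2 u, mismatch v u :&: G = finset.set0 &
    delta * n%:R ^+ 2 <= #|mismatch v u|%:R.

(** The net lemma with samples of about [n y] pairs, where [y = p n], and with
    [k] a quarter of the expected intersection [delta y n] of a sample with a
    large mismatch. The trace bound is used with [x = delta / 256]: the
    samples are capped at [m = 4 y n] pairs, so that traces are counted on
    [2 m] pairs by polynomials of degree [4 m], which costs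
    [16 x y n = delta y n / 16] in the exponent, against a gain of
    [delta y n / 8] from [2 ^ k]. *)
Lemma prob_many_mismatches (d n : nat) (v : 'I_n -> 'rV[R]_d) p delta :
  0 <= p -> p <= 1 -> 0 < delta -> 1 <= p * n%:R ->
  4 <= delta * (p * n%:R) * n%:R ->
  d%:R * (delta / 256 - ln (delta / 256)) + 1 <= delta / 16 * (p * n%:R) ->
  prob p (many_mismatches v delta) <= 12 * expR (- n%:R).
Proof.
move=> p0 p1 delta0; set y := p * n%:R => y1 y4 yd.
pose family S := exists2 u, S = mismatch v u & delta * n%:R ^+ 2 <= #|S|%:R.
have yn0 : 0 <= y * n%:R by rewrite mulr_ge0 // (le_trans ler01).
have dyn0 : 0 <= delta * y * n%:R by rewrite -mulrA mulr_ge0 // ltW.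
pose k := Num.trunc (delta * y * n%:R / 4).
pose m := Num.trunc (4 * (y * n%:R)).
have /andP[k_le k_gt] : k%:R <= delta * y * n%:R / 4 < k.+1%:R.
  by apply: truncn_itv; lra.
have /andP[m_le m_gt] : m%:R <= 4 * (y * n%:R) < m.+1%:R.
  by apply: truncn_itv; lra.
rewrite -(natr1 k) in k_gt; rewrite -(natr1 m) in m_gt.
apply: (@le_trans _ _ (prob p (fun G =>
    exists2 S, family S & S :&: G = finset.set0))).
  apply: prob_le => // G [u uG uc]; exists (mismatch v u) => //; by exists u.
apply: le_trans (prob_net p0 p1 (m := m) (k := k)
  (Phi := 'C(m.*2.*2 + n * d, n * d)) _ _) _.
- move=> X Xm; apply: leq_trans (card_traces_mismatch (v := v) X _) _.
    by move=> S [u -> _]; exists u.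
  by apply: leq_bin2l; rewrite leq_add2r leq_double.
- move=> S [u _ Sn]; apply: le_trans (prob_cardI_lt p0 p1 S k) _.
  have p2 : p / 2 <= 1 by lra.
  apply: le_trans (ler_pM _ _ (exp2_le k) (onem_exp_le #|S| p2)) _.
  - exact: exprn_ge0.
  - by rewrite exprn_ge0 // subr_ge0.
  rewrite -expRD -[leLHS]invrK lef_pV2 ?posrE ?invr_gt0 ?expR_gt0 //.
  rewrite -expRN; apply: le_trans le2_expR1 _; rewrite ler_expR.
  have : p * (delta * n%:R ^+ 2) <= p * #|S|%:R by rewrite ler_wpM2l.
  have -> : p * (delta * n%:R ^+ 2) = delta * y * n%:R by rewrite /y; ring.
  lra.
have card_bound : prob p (fun G : {set pair_of n} => (m < #|G|)%N) <=
    2 * expR (- n%:R).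
  apply: le_trans (prob_card_gt _ p0 p1 m) _.
  rewrite ler_pdivrMr ?exprn_gt0 //.
  apply: (@le_trans _ _ (expR (y * n%:R))); last first.
    apply: le_trans (ler_pM _ _ (ler_pM _ _ expR_half_le2 (lexx _))
      (exp2_ge m));
      rewrite ?mulr_ge0 ?expR_ge0 //.
    rewrite -!expRD ler_expR.
    have : n%:R <= y * n%:R by rewrite ler_peMl.
    lra.
  apply: (@le_trans _ _ (expR p ^+ #|{: pair_of n}|)).
    by rewrite lerXn2r ?nnegrE ?expR_ge0 ?addr_ge0 ?expR_ge1Dx.
  rewrite -expRM_natr ler_expR -[y * _]mulrA ler_wpM2l // -natrM ler_nat.
  rewrite card_sig.
  have -> : #|[pred e : {set 'I_n} | #|e| == 2%N]| = 'C(n, 2).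
    rewrite -[n in RHS]card_ord -card_draws; apply: eq_card => e.
    by rewrite !inE.
  by rewrite mulnn bin_le_expn.
have trace_bound : ('C(m.*2.*2 + n * d, n * d))%:R / 2 ^+ k <=
    2 * expR (- n%:R) :> R.
  have x0 : 0 < delta / 256 by lra.
  rewrite ler_pdivrMr ?exprn_gt0 //.
  apply: le_trans (bin_le_expR _ _ x0) _.
  apply: le_trans (ler_pM _ _ (ler_pM _ _ expR_half_le2 (lexx _)) (exp2_ge k));
    rewrite ?mulr_ge0 ?expR_ge0 //.
  rewrite -!expRD ler_expR !natrD natrM -!muln2 !natrM.
  have : n%:R * (d%:R * (delta / 256 - ln (delta / 256)) + 1) <=
      n%:R * (delta / 16 * y) by rewrite ler_wpM2l.
  have : delta / 256 * (m%:R * 2 * 2) <= delta / 256 * (4 * (y * n%:R) * 4).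
    by rewrite ler_wpM2l ?(ltW x0) //; lra.
  set l := ln _; lra.
by apply: le_trans (ler_wpM2l _ (lerD (ler_wpM2l _ card_bound) trace_bound)) _;
  rewrite //; lra.
Qed.

(** There are at most [n ^ b] sets of size [b], so the sum over spanning sets is
    at most the sum of [(p n) ^ b] for [b <= d]. *)
Lemma stray_bound_le (d n s h : nat) p a :
  0 <= p -> p <= 1 -> 1 <= p * n%:R -> a * n%:R <= (n - s - h)%:R ->
  stray_bound d n p s h <=
  d.+1%:R * (p * n%:R) ^+ d * expR (- (p * n%:R * a)).
Proof.
move=> p0 p1 y1 an; rewrite /stray_bound; apply: ler_pM.
- by apply: sumr_ge0 => B _; apply: exprn_ge0.
- by rewrite exprn_ge0 // subr_ge0.
- rewrite (partition_big (fun B : {set 'I_n} => inord #|B| : 'I_d.+1)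
    predT) //=.
  rewrite mulr_natl -[d.+1 in leRHS]card_ord -sumr_const.
  apply: ler_sum => b _.
  apply: (@le_trans _ _ (\sum_(B : {set 'I_n} | #|B| == b) p ^+ b)).
    rewrite big_mkcond [leRHS]big_mkcond /=; apply: ler_sum => B _.
    case: ifP => [/andP[Bd /eqP Bb]|_]; last by case: ifP; rewrite ?exprn_ge0.
    by rewrite -Bb inordK ?ltnS // eqxx.
  rewrite sumr_const.
  have -> : #|[pred B : {set 'I_n} | #|B| == b]| = 'C(n, b).
    rewrite -[n in RHS]card_ord -card_draws; apply: eq_card => e.
    by rewrite !inE.
  apply: (@le_trans _ _ ((p * n%:R) ^+ b)); last first.
    by rewrite ler_weXn2l // -ltnS.
  rewrite -[leLHS]mulr_natr exprMn ler_wpM2l ?exprn_ge0 // -natrX ler_nat.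
  exact: bin_le_expn.
apply: le_trans (onem_exp_le _ p1) _; rewrite ler_expR lerN2 -mulrA.
by rewrite ler_wpM2l // mulrC.
Qed.

End Estimates.

(** * From the estimates to the limit *)

Section Determination.
Variable R : realType.

Lemma reveal_probE (n : nat) (p : R) (E : {set pair_of n} -> Prop) :
  reveal_prob p E = prob p E.
Proof. by []. Qed.

(** The constant [eta ^+ 2 / (16 (2 + 2 d))] balances the two losses in
    [low_rank_zero_block]: with light rows having at most
    [eta n / (2 (2 + 2 d))] nonzero entries, heavy rows and bad columns remove
    at most [eta n / 2] indices each. *)
Lemma not_determines_mismatch (d n : nat) (tau eta : R) (v : 'I_n -> 'rV[R]_d)
    (G : {set pair_of n}) :
  injective v -> 0 < eta -> tau + eta < 1 -> (0 < n)%N ->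
  large_subsets_span tau v ->
  ~ determines v G ->
  many_mismatches v (eta ^+ 2 / (16 * (2 + 2 * d)%:R)) G \/
  some_stray v (Num.trunc (eta * n%:R)) G.
Proof.
move=> v_inj eta0 taueta n0 spanv ndet.
apply: contrapT => /not_orP[nmany nstray]; apply: ndet => u u_inj uvG.
have uvG0 := same_revealed_mismatch uvG.
pose D := (2 + 2 * d)%N; rewrite -/D in nmany.
have D0 : 0 < D%:R :> R by rewrite ltr0n.
have n0R : 0 < n%:R :> R by rewrite ltr0n.
have few : #|mismatch v u|%:R < eta ^+ 2 / (16 * D%:R) * n%:R ^+ 2 :> R.
  by rewrite ltNge; apply/negP => many; apply: nmany; exists u.
pose theta := Num.trunc (eta * n%:R / (2 * D%:R)).
have /andP[theta_le theta_gt] :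
    theta%:R <= eta * n%:R / (2 * D%:R) < theta.+1%:R.
  by apply: truncn_itv; rewrite divr_ge0 ?mulr_ge0 // ltW.
have [T uvT Tcard] := large_congruent_subset v u theta.
have T_le : (#|T| <= n)%N by rewrite -[n in leqRHS]card_ord max_card.
have Tn : (n - #|T|)%:R <= eta * n%:R :> R.
  have theta0 : 0 < theta.+1%:R :> R by rewrite ltr0n.
  rewrite -(ler_pM2r theta0).
  have TcardR : (n - #|T|)%:R * theta.+1%:R <=
      4 * #|mismatch v u|%:R + D%:R * theta%:R * theta.+1%:R :> R.
    by rewrite -!natrM -natrD ler_nat.
  apply: le_trans TcardR _.
  have theta_D : D%:R * theta%:R <= eta * n%:R / 2.
    apply: le_trans (ler_wpM2l (ltW D0) theta_le) _.
    by rewrite le_eqVlt; apply/orP; left; apply/eqP; field; rewrite gt_eqF.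
  have : D%:R * theta%:R * theta.+1%:R <= eta * n%:R / 2 * theta.+1%:R.
    by rewrite ler_wpM2r.
  have : eta * n%:R / 2 * (eta * n%:R / (2 * D%:R)) <=
      eta * n%:R / 2 * theta.+1%:R.
    apply: ler_wpM2l; last exact: ltW.
    by rewrite divr_ge0 ?mulr_ge0 // ltW.
  have -> : eta * n%:R / 2 * (eta * n%:R / (2 * D%:R)) =
      4 * (eta ^+ 2 / (16 * D%:R) * n%:R ^+ 2).
    by field; rewrite gt_eqF.
  lra.
have spanT : affinely_spans v T.
  apply: spanv; move: Tn; rewrite natrB //.
  have : (tau + eta) * n%:R < 1 * n%:R by rewrite ltr_pM2r.
  lra.
have [//|[W /andP[W0 Wn] strayW]] := stray_of_mismatch v_inj spanT uvT uvG0.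
case: nstray; exists W => //; rewrite W0 /=; apply: leq_trans Wn _.
by rewrite truncn_ge_nat // mulr_ge0 // ltW.
Qed.

Lemma coplanar_le (d n : nat) (tau : R) (v : 'I_n -> 'rV[R]_d)
    (S : {set 'I_n}) :
  0 <= tau -> large_subsets_span tau v -> coplanar v S ->
  (#|S| <= Num.trunc (tau * n%:R))%N.
Proof.
move=> tau0 spanv [a [c [a0 ac]]].
rewrite truncn_ge_nat ?mulr_ge0 // leNgt; apply/negP => /spanv.
exact: hyperplane_not_spanning a0 ac.
Qed.

(** The union of the two failure modes for a single [n], with [L] in the role
    of [ln n]. *)
Lemma reveal_prob_determines_ge (d n : nat) (tau eta C L : R)
    (v : 'I_n -> 'rV[R]_d) :
  let delta := eta ^+ 2 / (16 * (2 + 2 * d)%:R) in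
  let p := C * L / n%:R in
  let t := d.+1%:R * (C * L) ^+ d * expR (- (C * L * (1 - tau - eta))) in
  injective v -> 0 < tau -> 0 < eta -> tau + eta < 1 -> (0 < n)%N ->
  large_subsets_span tau v ->
  p <= 1 -> 1 <= C * L -> 4 <= delta * (C * L) * n%:R ->
  d%:R * (delta / 256 - ln (delta / 256)) + 1 <= delta / 16 * (C * L) ->
  1 - (12 * expR (- n%:R) + (expR (n%:R * t) - 1)) <=
  reveal_prob p (determines v).
Proof.
move=> delta p t v_inj tau0 eta0 taueta n0 spanv p1 CL1 CL4 CLd.
have n0R : 0 < n%:R :> R by rewrite ltr0n.
have pn : p * n%:R = C * L by rewrite /p divfK // gt_eqF.
have p0 : 0 <= p by rewrite divr_ge0 // (le_trans ler01).
have delta0 : 0 < delta.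
  by rewrite divr_gt0 ?exprn_gt0 // mulr_gt0 // ltr0n.
rewrite reveal_probE lerBlDl -lerBlDr -probC //.
pose s := Num.trunc (eta * n%:R); pose h := Num.trunc (tau * n%:R).
have sub G := @not_determines_mismatch d n tau eta v G v_inj eta0 taueta n0
  spanv.
apply: le_trans (prob_le p0 p1 sub) _.
apply: le_trans (probU p0 p1 (many_mismatches v delta) (some_stray v s)) _.
apply: lerD.
  by apply: prob_many_mismatches => //; rewrite pn.
have coplanar_card S : coplanar v S -> (#|S| <= h)%N.
  by apply: coplanar_le => //; apply: ltW.
apply: le_trans (prob_some_stray s p0 p1 coplanar_card) _.
rewrite lerD2r expRM_natl.
have t_bound : stray_bound d n p s h <= t.
  rewrite /t -pn; apply: stray_bound_le; rewrite ?pn //.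
  have := truncn_le (eta * n%:R); have := truncn_le (tau * n%:R).
  rewrite !mulr_ge0 ?(ltW tau0) ?(ltW eta0) // => h_le s_le.
  rewrite -subnDA natrB.
    by rewrite natrD; move: h_le s_le; rewrite -/s -/h; lra.
  rewrite -(ler_nat R) natrD; have : (tau + eta) * n%:R <= 1 * n%:R.
    by rewrite ler_wpM2r // ltW.
  by move: h_le s_le; rewrite -/s -/h; lra.
have sb0 : 0 <= stray_bound d n p s h by apply: stray_bound_ge0.
rewrite lerXn2r ?nnegrE ?expR_ge0 ?addr_ge0 //.
by apply: le_trans (expR_ge1Dx _) _; rewrite ler_expR.
Qed.

End Determination.

Local Open Scope classical_set_scope.

Lemma near_ln_ge (R : realType) (A : R) : \forall n \near \oo, A <= ln n%:R.
Proof.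
near=> n; have An : expR A <= n%:R.
  by near: n; apply: nbhs_infty_ger.
rewrite -[A]expRK ler_ln ?posrE ?expR_gt0 //.
by apply: lt_le_trans An; apply: expR_gt0.
Unshelve. all: by end_near.
Qed.

(** The choice of [eta] makes [C * (1 - tau - eta) = 1 + kappa] with
    [kappa > 0]. With [L = ln n], the sum over all points of the
    probability of being stray is at most
    [(d + 1) (C L)^d exp (- kappa L) <= K / L], because
    [exp (kappa L)] dominates [(kappa L)^(d + 1) / (d + 1)!]. *)
Lemma reveal_prob_determines_cvg (R : realType) (d : nat) (tau C : R)
    (V : forall n : nat, 'I_n -> 'rV[R]_d) :
  0 < tau -> tau < 1 -> 1 / (1 - tau) < C -> (forall n, injective (V n)) ->
  (\forall n \near \oo, large_subsets_span tau (V n)) ->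
  reveal_prob (C * ln n%:R / n%:R) (determines (V n)) @[n --> \oo] --> (1 : R).
Proof.
move=> tau0 tau1; rewrite ltr_pdivrMr ?subr_gt0 // => Ctau V_inj spanV.
have C1 : 1 < C by nra.
have C0 : 0 < C by apply: lt_trans C1.
pose eta := (C * (1 - tau) - 1) / (2 * C).
pose kappa := (C * (1 - tau) - 1) / 2.
have eta0 : 0 < eta by rewrite divr_gt0 ?mulr_gt0 // subr_gt0.
have kappa0 : 0 < kappa by rewrite divr_gt0 // subr_gt0.
have Ceta : C * eta = kappa by rewrite /eta /kappa; field; rewrite gt_eqF.
have Ck : C * (1 - tau - eta) = 1 + kappa.
  by rewrite mulrBr Ceta /kappa; field.
clearbody kappa.
have taueta : tau + eta < 1.
  have : 0 < C * (1 - tau - eta) by rewrite Ck addr_gt0.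
  by rewrite pmulr_rgt0 //; lra.
pose delta := eta ^+ 2 / (16 * (2 + 2 * d)%:R).
have delta0 : 0 < delta.
  by rewrite divr_gt0 ?exprn_gt0 // mulr_gt0 // ltr0n.
pose K := d.+1%:R * C ^+ d * d.+1`!%:R / kappa ^+ d.+1.
have K0 : 0 < K.
  by rewrite divr_gt0 ?exprn_gt0 // !mulr_gt0 ?exprn_gt0 ?ltr0n ?fact_gt0.
pose K' := d%:R * (delta / 256 - ln (delta / 256)) + 1.
apply/cvgrPdist_le => eps eps0.
near=> n.
have n0 : (0 < n)%N by near: n; apply: nbhs_infty_gt.
have n0R : 0 < n%:R :> R by rewrite ltr0n.
have L1 : 1 <= ln (n%:R : R) by near: n; apply: near_ln_ge.
have L2 : 2 * C <= ln (n%:R : R) by near: n; apply: near_ln_ge.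
have L3 : 4 / (delta * C) <= ln (n%:R : R) by near: n; apply: near_ln_ge.
have L4 : K' / (delta / 16 * C) <= ln (n%:R : R) by near: n; apply: near_ln_ge.
have L5 : 2 * K <= ln (n%:R : R) by near: n; apply: near_ln_ge.
have L6 : (12 + 2 * K) / eps <= ln (n%:R : R) by near: n; apply: near_ln_ge.
have spanVn : large_subsets_span tau (V n) by near: n.
set L := ln n%:R in L1 L2 L3 L4 L5 L6 *.
have nL : n%:R = expR L by rewrite lnK.
have L0 : 0 < L by apply: lt_le_trans L1.
have CL1 : 1 <= C * L by rewrite -[1]mulr1 ler_pM // ltW.
have n1 : 1 <= n%:R :> R by rewrite ler1n.
have Ln : L <= n%:R.
  by rewrite nL; apply: le_trans (expR_ge1Dx _); lra.
have p1 : C * L / n%:R <= 1.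
  rewrite ler_pdivrMr // mul1r nL.
  apply: le_trans (expR_ge1Dxn 1 (ltW L0)).
  have : 2 * C * L <= L * L by rewrite ler_wpM2r // ltW.
  by rewrite (_ : 2`! = 2)%N // expr2; lra.
have CL4 : 4 <= delta * (C * L) * n%:R.
  move: L3; rewrite ler_pdivrMr; last exact: mulr_gt0.
  have dCL0 : 0 <= delta * (C * L) by apply/ltW/mulr_gt0/mulr_gt0.
  have := ler_peMr dCL0 n1.
  lra.
have CLd : K' <= delta / 16 * (C * L).
  move: L4; rewrite ler_pdivrMr; last first.
    by apply: mulr_gt0 => //; apply: divr_gt0.
  lra.
have := @reveal_prob_determines_ge R d n tau eta C L (V n) (V_inj n) tau0 eta0
  taueta n0 spanVn p1 CL1 CL4 CLd.
set t := _ * _ ^+ d * _; set P := reveal_prob _ _ => P_ge.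
have P_le : P <= 1.
  by apply: prob_le1 => //; rewrite divr_ge0 ?mulr_ge0 // ltW.
have nt0 : 0 <= n%:R * t.
  by rewrite /t !mulr_ge0 ?exprn_ge0 ?expR_ge0 ?mulr_ge0 // ltW.
have nt : n%:R * t <= K / L.
  have -> : t = d.+1%:R * (C * L) ^+ d * (expR (- L) * expR (- (kappa * L))).
    rewrite /t -expRD; congr (_ * expR _). by rewrite mulrAC Ck; ring.
  have -> : n%:R *
      (d.+1%:R * (C * L) ^+ d * (expR (- L) * expR (- (kappa * L)))) =
      d.+1%:R * (C * L) ^+ d / expR (kappa * L).
    rewrite !expRN nL; field.
    by rewrite !gt_eqF ?expR_gt0.
  rewrite ler_pdivrMr ?expR_gt0 //.
  have kL : (kappa * L) ^+ d.+1 / d.+1`!%:R <= expR (kappa * L).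
    have kL0 : 0 <= kappa * L by apply/ltW/mulr_gt0.
    by apply: le_trans (expR_ge1Dxn d kL0); rewrite lerDr.
  apply: le_trans (ler_wpM2l _ kL); last exact/ltW/divr_gt0.
  rewrite le_eqVlt; apply/orP; left; apply/eqP.
  rewrite /K !exprMn !exprS; field.
  by rewrite !gt_eqF ?exprn_gt0 ?ltr0n ?fact_gt0.
have KL : K / L <= 2^-1 by rewrite ler_pdivrMr //; lra.
have e_nt : expR (n%:R * t) - 1 <= 2 * (K / L).
  apply: le_trans (expR_sub1_le nt0 (le_trans nt KL)) _.
  by rewrite ler_pM2l.
have e_n : expR (- n%:R) <= 1 / L :> R.
  rewrite expRN div1r lef_pV2 ?posrE ?expR_gt0 //.
  by apply: le_trans Ln _; apply: le_trans (expR_ge1Dx _); lra.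
have L6' : 12 * (1 / L) + 2 * (K / L) <= eps.
  have -> : 12 * (1 / L) + 2 * (K / L) = (12 + 2 * K) / L.
    by field; rewrite gt_eqF.
  move: L6; rewrite ler_pdivrMr // => L6.
  by rewrite ler_pdivrMr //; lra.
rewrite ger0_norm ?subr_ge0 //.
lra.
Unshelve. all: by end_near.
Qed.

Lemma line_large_subsets_span (R : realType) (n : nat) (tau : R)
    (v : 'I_n -> 'rV[R]_1) :
  injective v -> 1 <= tau * n%:R -> large_subsets_span tau v.
Proof.
move=> v_inj tau_n S /(le_lt_trans tau_n); rewrite ltr1n => /card_gt1P.
move=> [i [j [iS jS ij]]] x.
have vij : v j 0 0 - v i 0 0 != 0.
  rewrite subr_eq0; apply: contra ij => /eqP vji; apply/eqP/v_inj/rowP => k.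
  by rewrite !ord1.
pose b := (x 0 0 - v i 0 0) / (v j 0 0 - v i 0 0).
exists (fun l => if l == i then 1 - b else if l == j then b else 0).
have sumS (W : lmodType R) (f : 'I_n -> W) :
    (forall l, l != i -> l != j -> f l = 0) ->
    \sum_(l in S) f l = f i + f j.
  move=> f0; rewrite (bigD1 i) //= (bigD1 j) /=; last by rewrite jS eq_sym.
  by rewrite big1 ?addr0 // => l /andP[/andP[_ li] lj]; rewrite f0.
have ji : (j == i) = false by rewrite eq_sym (negbTE ij).
split.
  rewrite (sumS R^o) => [|l /negbTE -> /negbTE -> //].
  by rewrite eqxx ji eqxx subrK.
rewrite (sumS _) => [|l /negbTE -> /negbTE ->]; last by rewrite scale0r.
rewrite eqxx ji eqxx; apply/rowP => k; rewrite !ord1 !mxE /b.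
by field.
Qed.

Theorem theorem3 (R : realType) :
  (forall (d : nat) (tau C : R) (V : forall n : nat, 'I_n -> 'rV[R]_d),
     (1 <= d)%N -> 0 < tau -> tau < 1 -> 1 / (1 - tau) < C ->
     (forall n, injective (V n)) ->
     (\forall n \near \oo, large_subsets_span tau (V n)) ->
     reveal_prob (C * ln n%:R / n%:R) (determines (V n)) @[n --> \oo]
       --> (1 : R))
  /\
  (forall (C : R) (V : forall n : nat, 'I_n -> 'rV[R]_1),
     1 < C ->
     (forall n, injective (V n)) ->
     reveal_prob (C * ln n%:R / n%:R) (determines (V n)) @[n --> \oo]
       --> (1 : R)).
Proof.
split=> [d tau C V _|C V C1 V_inj]; first exact: reveal_prob_determines_cvg.
have C0 : 0 < C by apply: lt_trans C1.
have VC : C^-1 < 1 by rewrite invf_lt1.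
pose tau := (1 - C^-1) / 2.
have tau0 : 0 < tau by rewrite /tau; lra.
have V0 : 0 < C^-1 by rewrite invr_gt0.
apply: (@reveal_prob_determines_cvg _ _ tau) => //.
- by rewrite /tau; lra.
- rewrite ltr_pdivrMr ?subr_gt0; last by rewrite /tau; lra.
  have CV : C * C^-1 = 1 by rewrite divff // gt_eqF.
  by rewrite /tau; nra.
- near=> n; apply: line_large_subsets_span => //.
  rewrite mulrC -ler_pdivrMr // div1r.
  by near: n; apply: nbhs_infty_ger.
Unshelve. all: by end_near.
Qed.
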